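(* Consider the fully discrete nonuniform L2-$1_\sigma$ scheme (defined in the context) for the time-fractional Allen–Cahn model with $\alpha\in(0,1)$, $\epsilon>0$, mesh size $h$, and initial data with $\|\phi^0\|_\infty\le 1$. Assume $r_k\ge r_\star(\alpha)$ for all $k\ge2$, where $r_\star(\alpha)$ is the unique positive root $r$ of $$2\sqrt{\frac{2(1-\alpha/2)r}{1+\alpha+(1-\alpha/2)r}+\frac{r}{1+r}}+3-\frac{1}{r^2(1+r)}=0,$$ and, for all $1\le n\le N$, $$\tau_n\le\min\Big\{\Big(\frac{\theta\,\omega_{2-\alpha}(1-\theta)}{2(1-\theta)}\Big)^{1/\alpha},\ \Big(\frac{h^2\,\omega_{2-\alpha}(1-\theta)}{4\epsilon^2}\Big)^{1/\alpha}\Big\},\qquad\theta=\alpha/2.$$ Then the solution satisfies the discrete energy dissipation law $$\frac{\mathcal E_\alpha[\phi^n]-\mathcal E_\alpha[\phi^{n-1}]}{\tau_n}+\frac{\alpha}{2(2-\alpha)}a^{(n)}_0\,\tau_n\Big\|\frac{\phi^n-\phi^{n-1}}{\tau_n}\Big\|^2\le0\qquad\text{for }1\le n\le N.$$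
   Context: Time mesh $0=t_0<\cdots<t_N=T$, $\tau_k=t_k-t_{k-1}$, $r_k=\tau_k/\tau_{k-1}$; $\omega_\beta(t)=t^{\beta-1}/\Gamma(\beta)$; $t_{n-\theta}=\theta t_{n-1}+(1-\theta)t_n$; $\varpi_n'(t)=\omega_{1-\alpha}(t_{n-\theta}-t)$; $\nabla_\tau v^k=v^k-v^{k-1}$. For $1\le k\le n$: $a^{(n)}_{n-k}=\frac{1}{\tau_k}\int_{t_{k-1}}^{\min\{t_k,t_{n-\theta}\}}\varpi_n'(s)ds$, $\zeta^{(n)}_{n-k}=\frac{2}{\tau_k^2}\int_{t_{k-1}}^{t_k}(s-\frac{t_{k-1}+t_k}{2})\varpi_n'(s)ds$. L2-$1_\sigma$ formula: $(\partial^\alpha_\tau v)^{n-\theta}=a^{(n)}_0\nabla_\tau v^n+\sum_{k=1}^{n-1}\big(a^{(n)}_{n-k}\nabla_\tau v^k+\frac{\nabla_\tau v^{k+1}-r_{k+1}\nabla_\tau v^k}{r_{k+1}(1+r_{k+1})}\zeta^{(n)}_{n-k}\big)$. Kernels: $\hat a^{(1)}_0=\frac{2(1-\alpha)}{2-\alpha}a^{(1)}_0$; for $n\ge2$: $\hat a^{(n)}_0=\frac{2(1-\alpha)}{2-\alpha}a^{(n)}_0+\frac{\zeta^{(n)}_1}{r_n(1+r_n)}$, $\hat a^{(n)}_{n-k}=a^{(n)}_{n-k}+\frac{\zeta^{(n)}_{n-k+1}}{r_k(1+r_k)}-\frac{\zeta^{(n)}_{n-k}}{1+r_{k+1}}$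 ($2\le k\le n-1$), $\hat a^{(n)}_{n-1}=a^{(n)}_{n-1}-\frac{\zeta^{(n)}_{n-1}}{1+r_2}$; $A^{(n)}_0=2\hat a^{(n)}_0$, $A^{(n)}_{n-k}=\hat a^{(n)}_{n-k}$ ($1\le k\le n-1$). For $m\ge1$ and a sequence $w=(w^1,w^2,\dots)$: $\mathcal G_m[w]=\sum_{j=1}^{m-1}(A^{(m)}_{m-j-1}-A^{(m)}_{m-j})(\sum_{\ell=j+1}^m w^\ell)^2+A^{(m)}_{m-1}(\sum_{\ell=1}^m w^\ell)^2$, and $\mathcal G_0:=0$. Space: $\Omega=(0,L)^2$, $h=L/M$, grid $\{(ih,jh)\}$, $\Delta_h$ the standard five-point discrete Laplacian with periodic boundary conditions, $\nabla_h$ the corresponding discrete gradient (so that $\langle-\Delta_h u,v\rangle=\langle\nabla_h u,\nabla_h v\rangle$), $\langle u,v\rangle=h^2\sum u v$ the discrete inner product over grid points, $\|\cdot\|$ the discrete $L^2$ norm, $\|\cdot\|_\infty$ the grid maximum norm. Scheme, with $f(\phi)=\phi^3-\phi$: $(\partial^\alpha_\tau\phi)^{n-\theta}=-\big[\theta f(\phi^{n-1})+(1-\theta)f(\phi^n)-\epsilon^2\Delta_h(\theta\phi^{n-1}+(1-\theta)\phi^n)\big]$ for $n\ge1$, applied pointwise. Energies: $E[\phi^n]=\frac{\epsilon^2}{2}\|\nabla_h\phi^n\|^2+\langle F(\phi^n),1\rangle$ with $F(\phi)=\frac14(\phi^2-1)^2$, and the modified energy $\mathcal E_\alpha[\phi^n]=E[\phi^n]+\frac12\langle\mathcal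 G_n[\nabla_\tau\phi],1\rangle$ (pointwise in space, $\nabla_\tau\phi=(\nabla_\tau\phi^1,\nabla_\tau\phi^2,\dots)$), so $\mathcal E_\alpha[\phi^0]=E[\phi^0]$. *)

(* Defs.v *)
From HB Require Import structures.
From mathcomp Require Import all_boot all_order all_algebra.
From mathcomp Require Import all_classical all_reals all_analysis.
Set Implicit Arguments. Unset Strict Implicit. Unset Printing Implicit Defensive.
Import Order.TTheory GRing.Theory Num.Theory.
Import numFieldNormedType.Exports.
Local Open Scope classical_set_scope.
Local Open Scope ring_scope.

Section Defs.
Variable R : realType.

Definition GammaF (s : R) : R :=
  \int[@lebesgue_measure R]_(x in `]0%R, +oo[) (x `^ (s - 1) * expR (- x)).

Definition omegaF (beta t : R) : R := t `^ (beta - 1) / GammaF beta.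

Section Mesh.
Variables (t : nat -> R) (alpha theta : R).

Definition mtau (k : nat) : R := t k - t k.-1.
Definition mratio (k : nat) : R := mtau k / mtau k.-1.
Definition tsig (n : nat) : R := theta * t n.-1 + (1 - theta) * t n.
Definition varpi (n : nat) (s : R) : R := omegaF (1 - alpha) (tsig n - s).

Definition akern (n j : nat) : R :=
  let k := (n - j)%N in
  (mtau k)^-1 *
  \int[@lebesgue_measure R]_(s in `[t k.-1, Num.min (t k) (tsig n)]) varpi n s.

Definition zeta (n j : nat) : R :=
  let k := (n - j)%N in
  2 / (mtau k ^+ 2) *
  \int[@lebesgue_measure R]_(s in `[t k.-1, t k])
     ((s - (t k.-1 + t k) / 2) * varpi n s).

Definition L2sigma (n : nat) (v : nat -> R) : R :=
  let dv := fun k => v k - v k.-1 in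
  akern n 0 * dv n +
  \sum_(1 <= k < n)
     (akern n (n - k) * dv k
      + (dv k.+1 - mratio k.+1 * dv k) / (mratio k.+1 * (1 + mratio k.+1))
        * zeta n (n - k)).

Definition ahat (n j : nat) : R :=
  let c := 2 * (1 - alpha) / (2 - alpha) in
  if n == 0%N then 0
  else if n == 1%N then (if j == 0%N then c * akern 1 0 else 0)
  else if j == 0%N then c * akern n 0 + zeta n 1 / (mratio n * (1 + mratio n))
  else if (j < n.-1)%N then
    let k := (n - j)%N in
    akern n j + zeta n j.+1 / (mratio k * (1 + mratio k))
              - zeta n j / (1 + mratio k.+1)
  else if j == n.-1 then akern n n.-1 - zeta n n.-1 / (1 + mratio 2)
  else 0.

Definition Akern (n j : nat) : R :=
  if j == 0%N then 2 * ahat n 0 else ahat n j.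

Definition Gfun (m : nat) (w : nat -> R) : R :=
  if m == 0%N then 0 else
  \sum_(1 <= j < m)
     (Akern m (m - j - 1) - Akern m (m - j)) * (\sum_(j.+1 <= l < m.+1) w l) ^+ 2
  + Akern m (m - 1) * (\sum_(1 <= l < m.+1) w l) ^+ 2.

End Mesh.

(* ----- periodic space grid on (0,L)^2 with M x M points, spacing h ----- *)
Section Grid.
Variables (M : nat) (h : R).

Definition grid := 'I_M -> 'I_M -> R.

Definition lap (u : grid) : grid := fun i j =>
  (u (ordS i) j + u (ord_pred i) j + u i (ordS j) + u i (ord_pred j)
   - 4 * u i j) / h ^+ 2.

Definition ip (u v : grid) : R := h ^+ 2 * \sum_(i < M) \sum_(j < M) u i j * v i j.

(* ||grad_h u||^2 with forward differences, so that <-lap u, v> = <grad u, grad v> *)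
Definition gradsq (u : grid) : R :=
  h ^+ 2 * \sum_(i < M) \sum_(j < M)
    (((u (ordS i) j - u i j) / h) ^+ 2 + ((u i (ordS j) - u i j) / h) ^+ 2).

Definition fAC (x : R) : R := x ^+ 3 - x.
Definition FAC (x : R) : R := (x ^+ 2 - 1) ^+ 2 / 4.

Definition energy (eps : R) (u : grid) : R :=
  eps ^+ 2 / 2 * gradsq u + ip (fun i j => FAC (u i j)) (fun _ _ => 1).

Definition menergy (t : nat -> R) (alpha theta eps : R) (phi : nat -> grid) (n : nat) : R :=
  energy eps (phi n) +
  1 / 2 * ip (fun i j => Gfun t alpha theta n (fun l => phi l i j - phi l.-1 i j))
             (fun _ _ => 1).

Definition scheme_step (t : nat -> R) (alpha theta eps : R) (phi : nat -> grid) (n : nat) : Prop :=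
  forall i j,
    L2sigma t alpha theta n (fun k => phi k i j) =
    - (theta * fAC (phi n.-1 i j) + (1 - theta) * fAC (phi n i j)
       - eps ^+ 2 * lap (fun a b => theta * phi n.-1 a b + (1 - theta) * phi n a b) i j).

End Grid.

Definition rstar_eq (alpha r : R) : R :=
  2 * Num.sqrt (2 * (1 - alpha / 2) * r / (1 + alpha + (1 - alpha / 2) * r)
                + r / (1 + r))
  + 3 - 1 / (r ^+ 2 * (1 + r)).

End Defs.

(* Main.v *)
Require Import Defs.
From HB Require Import structures.
From mathcomp Require Import all_boot all_order all_algebra.
From mathcomp Require Import all_classical all_reals all_analysis.
From mathcomp Require Import measurable_realfun.
From mathcomp Require Import ring lra zify.
Import Order.TTheory GRing.Theory Num.Theory.
Import numFieldNormedType.Exports.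
Local Open Scope classical_set_scope.
Local Open Scope ring_scope.

(**
Write w^n for the increment of the solution and theta = alpha / 2.  The
L2-1_sigma formula equals theta / (1 - theta) a_0 w^n + sum_k ahat_{n-k} w^k.
An identity for quadratic forms turns 2 w^n sum_k ahat_{n-k} w^k into
G_n - G_{n-1} plus a form that is nonnegative as soon as
k |-> A^{(n-1)}(k) - A^{(n)}(k) is nonnegative and nondecreasing.  The latter
is a statement about the convex increasing function G = g_{n-1} - g_n, with
g_n(s) = (t_{n-theta} - s)^(-alpha) / Gamma(1 - alpha): comparing G with its
tangents gives, with D = G'(t_{k-1}), x = r_k, y = r_{k+1},
  G(t_k) - mean_k + zeta_k / y - zeta_{k-1} / (x (1 + x))
    >= (D tau_k / 6) (3 + 1/y - 1 / (x^2 (1 + x))),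
the condition on r_star bounds 1 / (x^2 (1 + x)) by 3 + 2 S, and 1/y - 2 S >= - S^2 y.

The maximum principle |phi| <= 1 cannot be obtained this way, because the
kernels need not satisfy ahat_0 >= ahat_1 when the ratios are only above r_star.
It is not needed: for theta <= 1/5 the nonlinear term is controlled without any
bound on phi, and for theta >= 1/5 the bound |phi| <= 2 suffices.  The latter
follows from B_0 - ahat_1 >= theta a_0, where B_0 is the full coefficient of w^n,
the deficit with respect to the maximum principle being absorbed by
phi^3 - phi > 0 at phi = 2.
*)

(** * Monotonicity and convexity of differences of negative powers *)

Section PowerDifference.
Variable R : realType.
Implicit Types (T b k s x y : R).

Lemma is_derive_powR_sub T b s : s < T ->
  is_derive s (1 : R) (fun u : R => (T - u) `^ (- b)) (b * (T - s) `^ (- (b + 1))).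
Proof.
move=> sT.
have h1 : is_derive s (1 : R) (fun u : R => T - u) (-1).
  apply: is_derive_eq (is_deriveB (is_derive_cst T s (1 : R)) (is_derive_id s (1 : R))) _.
  by rewrite add0r.
have h2 : is_derive (T - s) (1 : R) (fun v : R => v `^ (- b)) (- b * (T - s) `^ (- b - 1)).
  by apply: is_derive1_powR; rewrite subr_gt0.
have := @is_derive1_comp R (fun v : R => v `^ (- b)) (fun u => T - u) s _ _ h2 h1.
move=> h; apply: is_derive_eq h _.
by rewrite mulrN1 mulNr opprK -opprD.
Qed.

(** Up to a constant factor, [k = 1] gives the difference of the memory kernels of two time levels
    and [k = 0] a single kernel, so both are treated at once. The exponent [b] is free because
    differentiation maps the family into itself, raising [b] by one. *)
Definition powdiff k T T' b s : R := (T - s) `^ (- b) - k * (T' - s) `^ (- b).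

Lemma is_derive_powdiff k T T' b s : s < T -> T <= T' ->
  is_derive s (1 : R) (powdiff k T T' b) (b * powdiff k T T' (b + 1) s).
Proof.
move=> sT TT'.
have h1 := @is_derive_powR_sub T b s sT.
have h2 := @is_derive_powR_sub T' b s (lt_le_trans sT TT').
have h3 := is_deriveB h1 (is_deriveZ k h2).
apply: is_derive_eq h3 _.
by rewrite /powdiff /GRing.scale /= mulrBr mulrCA.
Qed.

Lemma powR_sub_antitone T T' b s : 0 <= b -> s < T -> T <= T' ->
  (T' - s) `^ (- b) <= (T - s) `^ (- b).
Proof.
move=> b0 sT TT'; rewrite !powRN lef_pV2 ?posrE ?powR_gt0 ?subr_gt0//; last lra.
by apply: ge0_ler_powR; rewrite ?nnegrE; lra.
Qed.

Lemma powdiff_ge0 k T T' b s : 0 <= b -> 0 <= k <= 1 -> s < T -> T <= T' ->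
  0 <= powdiff k T T' b s.
Proof.
move=> b0 /andP[k0 k1] sT TT'; rewrite /powdiff.
have := @powR_sub_antitone T T' b s b0 sT TT'.
have := powR_ge0 (T' - s) (- b).
nra.
Qed.

Lemma powdiff_continuous k T T' b (x y : R) : T <= T' -> y < T ->
  {within `[x, y], continuous (powdiff k T T' b)}.
Proof.
move=> TT' yT; apply: derivable_within_continuous => s; rewrite in_itv/= => /andP[_ sy].
by have [] := @is_derive_powdiff k T T' b s (le_lt_trans sy yT) TT'.
Qed.

Lemma ndecr_is_derive (f df : R -> R) (x y : R) : x <= y ->
  (forall s, x <= s <= y -> is_derive s (1 : R) f (df s)) ->
  (forall s, x <= s <= y -> 0 <= df s) -> f x <= f y.
Proof.
move=> xy h d0.
have sub s : s \in `]x, y[ -> x <= s <= y.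
  by rewrite in_itv/= => /andP[a b]; rewrite !ltW.
apply: (@ger0_derive1_ndecr R f x y) => // [s /sub hs|s /sub hs|].
- by have [] := h s hs.
- by rewrite derive1E; have [_ ->] := h s hs; exact: d0.
- by apply: derivable_within_continuous => s; rewrite in_itv/= => /h [].
Qed.

Lemma powdiff_mono k T T' b (x y : R) : 0 <= b -> 0 <= k <= 1 -> x <= y -> y < T -> T <= T' ->
  powdiff k T T' b x <= powdiff k T T' b y.
Proof.
move=> b0 k01 xy yT TT'.
have dG s : x <= s <= y ->
    is_derive s (1 : R) (powdiff k T T' b) (b * powdiff k T T' (b + 1) s).
  by move=> /andP[_ sy]; apply: is_derive_powdiff TT'; exact: le_lt_trans yT.
apply: (ndecr_is_derive _ _ _ _ xy dG) => s /andP[_ sy].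
by apply: mulr_ge0 => //; apply: powdiff_ge0 => //; [lra|exact: le_lt_trans yT].
Qed.

(** Convexity: to the right of [a] the derivative is at least its value at [a], so subtracting the
    linear function with that slope leaves a nondecreasing function. The companion lemma does the
    same to the left of [a]. *)
Lemma powdiff_slope_le k T T' b (a x y : R) : 0 <= b -> 0 <= k <= 1 ->
  a <= x -> x <= y -> y < T -> T <= T' ->
  powdiff k T T' b x - b * powdiff k T T' (b + 1) a * x <=
  powdiff k T T' b y - b * powdiff k T T' (b + 1) a * y.
Proof.
move=> b0 k01 ax xy yT TT'; set D := b * _.
pose f s := powdiff k T T' b s - D * s.
have df s : x <= s <= y -> is_derive s (1 : R) f (b * powdiff k T T' (b + 1) s - D).
  move=> /andP[xs sy].
  have h1 := is_derive_powdiff k T T' b s (le_lt_trans sy yT) TT'.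
  have h2 := is_deriveZ D (is_derive_id s (1 : R)).
  apply: is_derive_eq (is_deriveB h1 h2) _.
  by rewrite /GRing.scale/= mulr1.
apply: (ndecr_is_derive _ _ _ _ xy df) => s /andP[xs sy].
rewrite -mulrBr; apply: mulr_ge0 => //; rewrite subr_ge0.
apply: powdiff_mono => //; [lra|exact: le_trans xs|exact: le_lt_trans yT].
Qed.

Lemma powdiff_slope_ge k T T' b (a x y : R) : 0 <= b -> 0 <= k <= 1 ->
  x <= y -> y <= a -> a < T -> T <= T' ->
  b * powdiff k T T' (b + 1) a * x - powdiff k T T' b x <=
  b * powdiff k T T' (b + 1) a * y - powdiff k T T' b y.
Proof.
move=> b0 k01 xy ya aT TT'; set D := b * _.
pose f s := D * s - powdiff k T T' b s.
have df s : x <= s <= y -> is_derive s (1 : R) f (D - b * powdiff k T T' (b + 1) s).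
  move=> /andP[xs sy]; have sa := le_trans sy ya.
  have h1 := is_derive_powdiff k T T' b s (le_lt_trans sa aT) TT'.
  have h2 := is_deriveZ D (is_derive_id s (1 : R)).
  apply: is_derive_eq (is_deriveB h2 h1) _.
  by rewrite /GRing.scale/= mulr1.
apply: (ndecr_is_derive _ _ _ _ xy df) => s /andP[xs sy].
rewrite -mulrBr; apply: mulr_ge0 => //; rewrite subr_ge0.
apply: powdiff_mono => //; [lra|exact: le_trans ya].
Qed.
End PowerDifference.

(** * Zeroth and first moments of a function on an interval *)

Section Moments.
Variable R : realType.
Notation mu := (@lebesgue_measure R).
Implicit Types (f g : R -> R) (a b c d e x y : R).

(** [mean] and [tilt] have the shape of the coefficients a (away from the diagonal) and zeta of the
    scheme. On an affine function of slope D the value of [tilt] is D (b - a) / 6. *)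
Definition mean f a b : R := (b - a)^-1 * \int[mu]_(s in `[a, b]) f s.
Definition tilt f a b : R :=
  2 / (b - a) ^+ 2 * \int[mu]_(s in `[a, b]) ((s - (a + b) / 2) * f s).

Lemma tilt_diag f a : tilt f a a = 0.
Proof. by rewrite /tilt subrr expr0n /= invr0 mulr0 mul0r. Qed.

Lemma integrable_itv f a b : {within `[a, b], continuous f} ->
  mu.-integrable `[a, b] (EFin \o f).
Proof.
by move=> cf; apply: continuous_compact_integrable => //; exact: segment_compact.
Qed.

Lemma continuous_quadratic c d e m a b :
  {within `[a, b], continuous (fun s : R => c + d * (s - m) + e * (s - m) ^+ 2)}.
Proof.
apply: continuous_subspaceT => s.
apply: cvgD; first apply: cvgD; [exact: cvg_cst| |].
- by apply: cvgM; [exact: cvg_cst|apply: cvgB; [exact: cvg_id|exact: cvg_cst]].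
- apply: cvgM; [exact: cvg_cst|].
  by rewrite expr2; apply: cvgM; (apply: cvgB; [exact: cvg_id|exact: cvg_cst]).
Qed.

Lemma Rintegral_quadratic c d e a b : a < b ->
  \int[mu]_(s in `[a, b]) (c + d * (s - (a + b) / 2) + e * (s - (a + b) / 2) ^+ 2)
  = c * (b - a) + e * (b - a) ^+ 3 / 12.
Proof.
move=> ab; set m := (a + b) / 2.
pose F s := c * s + d / 2 * (s - m) ^+ 2 + e / 3 * (s - m) ^+ 3.
have dF s : is_derive s (1 : R) F (c + d * (s - m) + e * (s - m) ^+ 2).
  apply: is_derive_eq.
  by rewrite /GRing.scale/=; field.
have cF s : {for s, continuous F}.
  by apply: differentiable_continuous; apply/derivable1_diffP; have [] := dF s.
rewrite /Rintegral (@continuous_FTC2 R _ F) //.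
- by rewrite /F /m /=; field.
- exact: continuous_quadratic.
- split; first by move=> s _; have [] := dF s.
  + exact: cvg_at_right_filter (cF a).
  + exact: cvg_at_left_filter (cF b).
- by move=> s _; rewrite derive1E; have [_ ->] := dF s.
Qed.

Lemma within_continuousM f g (A : set R) : {within A, continuous f} ->
  {within A, continuous g} -> {within A, continuous (fun s => f s * g s)}.
Proof. by move=> cf cg s; exact: (continuousM (cf s) (cg s)). Qed.

Lemma within_continuousD f g (A : set R) : {within A, continuous f} ->
  {within A, continuous g} -> {within A, continuous (fun s => f s + g s)}.
Proof. by move=> cf cg s; exact: (continuousD (cf s) (cg s)). Qed.

Lemma within_continuousZ f (A : set R) k : {within A, continuous f} ->
  {within A, continuous (fun s => k * f s)}.
Proof. by apply: within_continuousM => s; exact: cst_continuous. Qed.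

Lemma continuous_center_mul f a b : {within `[a, b], continuous f} ->
  {within `[a, b], continuous (fun s : R => (s - (a + b) / 2) * f s)}.
Proof.
apply: within_continuousM; apply: continuous_subspaceT => s.
by apply: cvgB; [exact: cvg_id|exact: cvg_cst].
Qed.

(** The average of f against the weight u + v (2 (s - m) / (b - a)), m the midpoint, is exactly the
    combination of [mean] and [tilt] on the left. The coefficient [d] is free since s - m has
    integral zero, so every moment estimate below reduces to a pointwise bound by a quadratic. *)
Lemma weighted_moment_le f a b u v c d e : a < b -> {within `[a, b], continuous f} ->
  (forall s, a <= s <= b ->
    (u + v * (2 * (s - (a + b) / 2) / (b - a))) * f s <=
    c + d * (s - (a + b) / 2) + e * (s - (a + b) / 2) ^+ 2) ->
  u * mean f a b + v * tilt f a b <= c + e * (b - a) ^+ 2 / 12.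
Proof.
move=> ab cf h.
have cw := continuous_center_mul _ _ _ cf.
have iu : mu.-integrable `[a, b] (EFin \o (fun s => u * f s)).
  by apply: integrable_itv; exact: within_continuousZ.
have iv : mu.-integrable `[a, b]
    (EFin \o (fun s => v * 2 / (b - a) * ((s - (a + b) / 2) * f s))).
  by apply: integrable_itv; exact: within_continuousZ.
have : \int[mu]_(s in `[a, b])
    (u * f s + v * 2 / (b - a) * ((s - (a + b) / 2) * f s)) <=
  \int[mu]_(s in `[a, b]) (c + d * (s - (a + b) / 2) + e * (s - (a + b) / 2) ^+ 2).
  apply: le_Rintegral => //.
  - apply: integrable_itv; apply: within_continuousD; exact: within_continuousZ.
  - exact/integrable_itv/continuous_quadratic.
  - move=> s /=; rewrite in_itv/= => /h; apply: le_trans.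
    by rewrite le_eqVlt; apply/orP; left; apply/eqP; ring.
rewrite Rintegral_quadratic// RintegralD//.
rewrite (@RintegralZl _ _ _ _ _ _ u)//; last exact: integrable_itv.
rewrite (@RintegralZl _ _ _ _ _ _ (v * 2 / (b - a)))//; last exact: integrable_itv.
rewrite /mean /tilt.
set I1 := Rintegral _ _ _; set I2 := Rintegral _ _ _ => H.
have ba : 0 < b - a by rewrite subr_gt0.
have -> : u * ((b - a)^-1 * I1) + v * (2 / (b - a) ^+ 2 * I2)
  = (u * I1 + v * 2 / (b - a) * I2) / (b - a) by field; rewrite gt_eqF.
rewrite ler_pdivrMr//; apply: le_trans H _.
by rewrite le_eqVlt; apply/orP; left; apply/eqP; ring.
Qed.

Lemma mean_linear f g a b k : {within `[a, b], continuous f} ->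
  {within `[a, b], continuous g} ->
  mean (fun s => f s - k * g s) a b = mean f a b - k * mean g a b.
Proof.
move=> cf cg; rewrite /mean RintegralB//; try exact: integrable_itv.
  by rewrite RintegralZl//; [ring|exact: integrable_itv].
by apply: integrable_itv; exact: within_continuousZ.
Qed.

Lemma tilt_linear f g a b k : {within `[a, b], continuous f} ->
  {within `[a, b], continuous g} ->
  tilt (fun s => f s - k * g s) a b = tilt f a b - k * tilt g a b.
Proof.
move=> cf cg; rewrite /tilt.
have -> : (fun s => (s - (a + b) / 2) * (f s - k * g s)) =
   (fun s => (s - (a + b) / 2) * f s - k * ((s - (a + b) / 2) * g s)).
  by apply/funext => s; ring.
have cwf := continuous_center_mul _ _ _ cf.
have cwg := continuous_center_mul _ _ _ cg.
rewrite RintegralB//; try exact: integrable_itv.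
  by rewrite RintegralZl//; [ring|exact: integrable_itv].
by apply: integrable_itv; exact: within_continuousZ.
Qed.

Section Slope.
Variables (f : R -> R) (a b D : R).
Hypothesis ab : a < b.
Hypothesis cf : {within `[a, b], continuous f}.

Let ba : 0 < b - a. Proof. by rewrite subr_gt0. Qed.

Section SlopeGe.
Hypothesis slope : forall x y, a <= x -> x <= y -> y <= b -> f x - D * x <= f y - D * y.

Lemma mean_slope_le : mean f a b <= f b - D * (b - a) / 2.
Proof.
have := @weighted_moment_le f a b 1 0 (f b - D * (b - a) / 2) D 0 ab cf.
rewrite mul1r !mul0r !addr0; apply => s /andP[as_ sb].
have := slope _ _ as_ sb (lexx b).
by rewrite mul0r addr0 mul1r mul0r addr0; lra.
Qed.

(** With q(s) = f s - D s nondecreasing, (s - m) (q s - q m) is nonnegative on both sides of the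
    midpoint m. Integrating it leaves D times the moment of (s - m)^2. *)
Lemma tilt_slope_ge : D * (b - a) / 6 <= tilt f a b.
Proof.
pose m := (a + b) / 2.
have := @weighted_moment_le f a b 0 (- 1) 0 (- (2 * f m / (b - a))) (- (2 * D / (b - a))) ab cf.
rewrite mul0r !add0r mulN1r.
have -> : - (2 * D / (b - a)) * (b - a) ^+ 2 / 12 = - (D * (b - a) / 6).
  by field; rewrite gt_eqF.
rewrite lerN2; apply => s /andP[as_ sb]; rewrite !add0r -/m -subr_ge0.
have -> : - (2 * f m / (b - a)) * (s - m) + - (2 * D / (b - a)) * (s - m) ^+ 2 -
   -1 * (2 * (s - m) / (b - a)) * f s =
   2 / (b - a) * ((s - m) * ((f s - D * s) - (f m - D * m))) by ring.
apply: mulr_ge0; first by apply: divr_ge0 => //; exact: ltW.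
have am : a <= m <= b by rewrite /m; apply/andP; split; lra.
have /andP[am1 am2] := am.
have [sm|ms] := leP s m.
  have := slope _ _ as_ sm am2; nra.
have := slope _ _ am1 (ltW ms) sb; nra.
Qed.

(** The weight 1 - 2 l (s - m) / (b - a) is nonnegative on the interval because [l <= 1], so f may
    be replaced under it by its lower bound f a + D (s - a). *)
Lemma mean_tilt_slope_ge l : 0 <= l <= 1 ->
  f a + D * (b - a) * (1 / 2 - l / 6) <= mean f a b - l * tilt f a b.
Proof.
move=> /andP[l0 l1]; pose m := (a + b) / 2.
pose w := 2 * l / (b - a).
have := @weighted_moment_le f a b (- 1) l (- (f a + D * (m - a)))
  (w * (f a + D * (m - a)) - D) (D * w) ab cf.
have -> : - (f a + D * (m - a)) + D * w * (b - a) ^+ 2 / 12 =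
   - (f a + D * (b - a) * (1 / 2 - l / 6)).
  by rewrite /w /m; field; rewrite gt_eqF.
have -> : - 1 * mean f a b + l * tilt f a b = - (mean f a b - l * tilt f a b) by ring.
rewrite lerN2; apply => s /andP[as_ sb]; rewrite -/m -subr_ge0.
have -> : - (f a + D * (m - a)) + (w * (f a + D * (m - a)) - D) * (s - m) +
   D * w * (s - m) ^+ 2 - (-1 + l * (2 * (s - m) / (b - a))) * f s =
   (1 - l * (2 * (s - m) / (b - a))) * ((f s - D * s) - (f a - D * a)).
  by rewrite /w; field; rewrite gt_eqF.
apply: mulr_ge0; last by rewrite subr_ge0; exact: slope.
rewrite subr_ge0 mulrA ler_pdivrMr// mul1r /m; nra.
Qed.

End SlopeGe.

Lemma tilt_slope_le :
  (forall x y, a <= x -> x <= y -> y <= b -> D * x - f x <= D * y - f y) ->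
  tilt f a b <= D * (b - a) / 6.
Proof.
move=> slope; pose m := (a + b) / 2.
have := @weighted_moment_le f a b 0 1 0 (2 * f m / (b - a)) (2 * D / (b - a)) ab cf.
rewrite mul0r !add0r mul1r.
have -> : 2 * D / (b - a) * (b - a) ^+ 2 / 12 = D * (b - a) / 6.
  by field; rewrite gt_eqF.
apply => s /andP[as_ sb]; rewrite !add0r -/m -subr_ge0.
have -> : 2 * f m / (b - a) * (s - m) + 2 * D / (b - a) * (s - m) ^+ 2 -
   1 * (2 * (s - m) / (b - a)) * f s =
   2 / (b - a) * ((s - m) * ((D * s - f s) - (D * m - f m))) by ring.
apply: mulr_ge0; first by apply: divr_ge0 => //; exact: ltW.
have am : a <= m <= b by rewrite /m; apply/andP; split; lra.
have /andP[am1 am2] := am.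
have [sm|ms] := leP s m.
  have := slope _ _ as_ sm am2; nra.
have := slope _ _ am1 (ltW ms) sb; nra.
Qed.

End Slope.
End Moments.

(** * Integrals of powers singular at an endpoint *)

Section SingularIntegrals.
Variable R : realType.
Notation mu := (@lebesgue_measure R).

Lemma integral_is_derive (f F : R -> R) (a b : R) : a < b ->
  (forall s, a <= s <= b -> is_derive s (1 : R) F (f s)) ->
  {within `[a, b], continuous f} ->
  (\int[mu]_(s in `[a, b]) (f s)%:E = (F b - F a)%:E)%E.
Proof.
move=> ab dF cf.
have sub s : s \in `]a, b[ -> a <= s <= b.
  by rewrite in_itv/= => /andP[x y]; rewrite !ltW.
have cF s : a <= s <= b -> {for s, continuous F}.
  move=> /dF [dFs _].
  by apply: differentiable_continuous; apply/derivable1_diffP.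
rewrite (@continuous_FTC2 R _ F) ?EFinB//.
- split; first by move=> s /sub /dF [].
  + by apply: cvg_at_right_filter; apply: cF; rewrite lexx ltW.
  + by apply: cvg_at_left_filter; apply: cF; rewrite lexx ltW.
- by move=> s /sub /dF [_ dFs]; rewrite derive1E.
Qed.

Lemma integral_itv_exhaustion (f : R -> R) (U : set R) (a b : nat -> R) :
  (forall s, 0 <= f s) -> measurable_fun setT f ->
  nonincreasing_seq a -> nondecreasing_seq b ->
  U = \bigcup_n `[a n, b n]%classic ->
  (\int[mu]_(s in `[a n, b n]) (f s)%:E @[n --> \oo] -->
   \int[mu]_(s in U) (f s)%:E)%E.
Proof.
move=> f0 mf na nb ->.
apply: ge0_nondecreasing_set_cvg_integral => //.
- move=> i j ij; rewrite subsetEset; apply: subset_itv; rewrite bnd_simp.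
    exact: na.
  exact: nb.
- by move=> i; apply/measurable_EFinP; exact: measurable_funTS.
- by move=> i x _; rewrite lee_fin.
Qed.

Lemma measurable_powR_sub (T r : R) : measurable_fun setT (fun s : R => (T - s) `^ r).
Proof.
apply: (measurableT_comp (measurable_powR r)).
by apply: measurable_funB => //; exact: measurable_cst.
Qed.

Lemma cvg_powR_seq (u : nat -> R) (r : R) : 0 < r -> (forall n, 0 < u n) ->
  u n @[n --> \oo] --> (0 : R) -> u n `^ r @[n --> \oo] --> (0 : R).
Proof.
move=> r0 u0 cu.
have cu0 : u n @[n --> \oo] --> (0 : R)^'+.
  move=> A hA; have h : \forall n \near \oo, 0 < u n -> A (u n) by exact: (cu _ hA).
  by apply: filterS h => n; apply; exact: u0.
by apply: (@cvg_comp _ _ _ u (fun x : R => x `^ r) _ _ _ cu0); exact: powR_cvg0.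
Qed.

(** The integrand blows up at [T], so the fundamental theorem is applied on intervals ending before
    [T] and monotone convergence gives the limit. *)
Lemma integral_powR_sub (al a T : R) : 0 < al < 1 -> a < T ->
  (\int[mu]_(s in `[a, T]) ((T - s) `^ (- al))%:E =
   ((T - a) `^ (1 - al) / (1 - al))%:E)%E.
Proof.
move=> /andP[al0 al1] aT.
(* [harmonic n.+1] is 1 / (n + 2), which keeps [b n] strictly between [a] and [T] already at n =
   0. *)
pose b n : R := T - (T - a) * harmonic n.+1.
have h0 n : 0 < (harmonic n : R) by rewrite /= invr_gt0.
have h1 n : (harmonic n.+1 : R) < 1 by rewrite /= invf_lt1// ltr1n.
have Ta : 0 < T - a by rewrite subr_gt0.
have bT n : b n < T by rewrite /b ltrBlDr ltrDl mulr_gt0.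
have ab n : a < b n by rewrite /b; have := h1 n; nra.
have bnd : nondecreasing_seq b.
  apply/nondecreasing_seqP => n; rewrite /b lerD2l lerN2 ler_pM2l//.
  by rewrite /= lef_pV2 ?posrE// ler_nat.
have bcvg : b n @[n --> \oo] --> T.
  rewrite -[X in _ --> X]subr0 -[X in T - X](mulr0 (T - a)).
  apply: cvgB; first exact: cvg_cst.
  apply: cvgM; first exact: cvg_cst.
  by have := @cvg_harmonic R; rewrite -cvg_shiftS.
have cov : [set` `[a, T[%R] = \bigcup_n `[a, b n]%classic.
  apply/seteqP; split => [x /=|x [n _] /=]; rewrite !in_itv/=.
    move=> /andP[ax xT].
    have : \forall n \near \oo, x <= b n.
      by near=> n; apply/ltW; near: n; apply: cvgr_gt xT; exact: bcvg.
    move=> [n _ /(_ n (leqnn n)) xb]; exists n => //=.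
    by rewrite in_itv/= ax xb.
  by move=> /andP[-> /le_lt_trans]; exact.
pose f s : R := (T - s) `^ (- al).
have := @integral_itv_exhaustion f _ (fun=> a) b (fun s => powR_ge0 _ _)
  (measurable_powR_sub T (- al)) _ bnd cov.
have -> : (fun n => \int[mu]_(s in `[a, b n]) (f s)%:E)%E =
   (fun n => (((T - a) `^ (1 - al) - (T - b n) `^ (1 - al)) / (1 - al))%:E).
  apply/funext => n.
  have dF s : a <= s <= b n ->
      is_derive s (1 : R) (fun s => - (1 - al)^-1 * (T - s) `^ (- (al - 1))) (f s).
    move=> /andP[_ sb].
    have h := is_deriveZ (- (1 - al)^-1)
      (is_derive_powR_sub R T (al - 1) s (le_lt_trans sb (bT n))).
    apply: is_derive_eq h _.
    rewrite subrK /f /GRing.scale/= mulrA -[RHS]mul1r; congr (_ * _).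
    by field; rewrite subr_eq0 gt_eqF.
  have cf : {within `[a, b n], continuous f}.
    apply: derivable_within_continuous => s; rewrite in_itv/= => /andP[_ sb].
    by have [] := is_derive_powR_sub R T al s (le_lt_trans sb (bT n)).
  by rewrite (integral_is_derive _ _ _ _ (ab n) dF cf) /= !(opprB al); congr EFin; ring.
move=> /(_ (fun _ _ _ => lexx _)) H.
have lim : (((T - a) `^ (1 - al) - (T - b n) `^ (1 - al)) / (1 - al))%:E @[n --> \oo] -->
   ((T - a) `^ (1 - al) / (1 - al))%:E.
  apply: cvg_EFin; first exact: nearW.
  apply: cvgM; last exact: cvg_cst.
  rewrite -[X in _ --> X]subr0; apply: cvgB; first exact: cvg_cst.
  apply: cvg_powR_seq => [|n|]; [by rewrite subr_gt0|by rewrite subr_gt0|].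
  by rewrite -[X in _ --> X](subrr T); apply: cvgB => //; exact: cvg_cst.
have := cvg_unique _ H lim => //.
rewrite -integral_itv_bndo_bndc; last first.
  by apply/measurable_EFinP/measurable_funTS; exact: measurable_powR_sub.
by move=> ->.
Unshelve. all: by end_near. Qed.

End SingularIntegrals.

(** * Positivity of the Gamma function and one half of its functional equation *)

Section GammaFunction.
Variable R : realType.
Notation mu := (@lebesgue_measure R).

Lemma measurable_powR_expRN (r : R) : measurable_fun setT (fun x : R => x `^ r * expR (- x)).
Proof.
apply: measurable_funM; first exact: measurable_powR.
apply: (measurableT_comp (@measurable_expR R)).
exact: oppr_measurable.
Qed.

Lemma powR_expRN_ge0 (r x : R) : 0 <= x `^ r * expR (- x).
Proof. by rewrite mulr_ge0 ?powR_ge0 ?expR_ge0. Qed.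

Lemma is_derive_powR_expRN (r x : R) : 0 < x -> is_derive x (1 : R)
  (fun x : R => x `^ r * expR (- x))
  (r * (x `^ (r - 1) * expR (- x)) - x `^ r * expR (- x)).
Proof.
move=> x0.
have h1 : is_derive x (1 : R) (fun v : R => v `^ r) (r * x `^ (r - 1)).
  exact: is_derive1_powR.
have h2 : is_derive x (1 : R) (fun v : R => expR (- v)) (- expR (- x)).
  have hN := is_deriveN (is_derive_id x (1 : R)).
  have := @is_derive1_comp R expR (fun v => - v) x _ _ (is_derive_expR (- x)) hN.
  by move=> h; apply: is_derive_eq h _; rewrite mulrN1.
apply: is_derive_eq (is_deriveM h1 h2) _.
by rewrite /GRing.scale/=; ring.
Qed.

Lemma continuous_powR_expRN (r a b : R) : 0 < a ->
  {within `[a, b], continuous (fun x : R => x `^ r * expR (- x))}.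
Proof.
move=> a0; apply: derivable_within_continuous => s; rewrite in_itv/= => /andP[sa _].
by have [] := is_derive_powR_expRN r s (lt_le_trans a0 sa).
Qed.

(** The first bound is an integrable majorant, from x^r <= 1 + x <= 2 exp(x / 2). The second
    controls the boundary term at infinity in an integration by parts. *)
Lemma powR_expRN_bounds (r x : R) : 0 < r < 1 -> 0 < x ->
  x `^ r * expR (- x) <= 2 * expR (- (x / 2)) /\ (1 <= x -> x `^ r * expR (- x) <= 2 / x).
Proof.
move=> /andP[r0 r1] x0.
have xr : x `^ r <= 1 + x.
  have [x1|/ltW x1] := leP 1 x.
    by apply: le_trans (ler1_powR x1 (ltW r1)) _; lra.
  have : x `^ r <= 1.
    have -> : 1 = 1 `^ r :> R by rewrite /powR oner_eq0 ln1 mulr0 expR0.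
    by apply: ge0_ler_powR; rewrite ?nnegrE//; lra.
  lra.
split.
  have e2 := expR_ge1Dx (x / 2).
  have -> : - x = - (x / 2) + - (x / 2) by field.
  have EE : expR (x / 2) * expR (- (x / 2)) = 1 by rewrite -expRD subrr expR0.
  rewrite expRD mulrA ler_pM2r ?expR_gt0//.
  have E0 := expR_gt0 (- (x / 2)); nra.
move=> x1.
have xr1 := ler1_powR x1 (ltW r1).
have := expR_ge1Dxn 1 (ltW x0); rewrite /= => e2.
rewrite expRN -(ler_pM2r (expR_gt0 x)) mulfVK ?gt_eqF ?expR_gt0//.
rewrite mulrAC ler_pdivlMr//.
have : x ^+ 2 / 2 <= expR x.
  by move: e2; rewrite (_ : 2`! = 2)%N//; lra.
nra.
Qed.

Lemma integral_powR_expRN_lty (r : R) : 0 < r < 1 ->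
  (\int[mu]_(x in `]0%R, +oo[) (x `^ r * expR (- x))%:E < +oo)%E.
Proof.
move=> r01.
(* Four times the exponential density of rate 1/2 is 2 exp(- x / 2), the majorant of
   [powR_expRN_bounds]; the density has total mass one. *)
have mexp : measurable_fun setT (fun x : R => 4 * exponential_pdf 2^-1 x).
  by apply: measurable_funM => //; exact: measurable_exponential_pdf.
apply: (@le_lt_trans _ _ (\int[mu]_x (4 * exponential_pdf (2^-1 : R) x)%:E)%E).
  apply: (@le_trans _ _ (\int[mu]_(x in `]0%R, +oo[) (4 * exponential_pdf (2^-1 : R) x)%:E)%E).
    apply: ge0_le_integral => //=.
    - by move=> x _; rewrite lee_fin powR_expRN_ge0.
    - by apply/measurable_EFinP/measurable_funTS; exact: measurable_powR_expRN.
    - by apply/measurable_EFinP/measurable_funTS; exact: mexp.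
    - move=> x; rewrite in_itv/= andbT => x0; rewrite lee_fin.
      have [h _] := powR_expRN_bounds r x r01 x0.
      rewrite (exponential_pdfE _ (ltW x0)); apply: le_trans h _.
      have -> : - 2^-1 * x = - (x / 2) by rewrite mulNr mulrC.
      rewrite mulrA; apply: ler_wpM2r; [exact: expR_ge0|lra].
  apply: ge0_subset_integral => //=.
  - exact/measurable_EFinP.
  - move=> x _; rewrite lee_fin mulr_ge0//; apply: exponential_pdf_ge0; lra.
under eq_integral do rewrite EFinM.
rewrite ge0_integralZl//=.
- rewrite integral_exponential_pdf ?mule1 ?ltry// invr_gt0//.
- by apply/measurable_EFinP; exact: measurable_exponential_pdf.
- by move=> x _; rewrite lee_fin; apply: exponential_pdf_ge0; lra.
Qed.

(** Integrate the derivative of x^r exp(-x) over [1 / (n + 2), n + 2]: the boundary term at the left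
    end has a favourable sign and the one at the right end is at most 2 / (n + 2), so the inequality
    appears in the limit without computing either limit exactly. *)
Lemma Gamma_succ_ge (r : R) : 0 < r < 1 -> 0 < r * GammaF r <= GammaF (r + 1).
Proof.
move=> r01; have /andP[r0 r1] := r01.
pose f p x : R := x `^ p * expR (- x).
pose I (U : set R) p : \bar R := (\int[mu]_(x in U) (f p x)%:E)%E.
have J0 : (0 <= I `]0%R, +oo[%classic r)%E.
  by apply: integral_ge0 => x _; rewrite lee_fin powR_expRN_ge0.
have Joo : (I `]0%R, +oo[%classic r < +oo)%E by exact: integral_powR_expRN_lty.
have Jfin : I `]0%R, +oo[%classic r \is a fin_num by rewrite ge0_fin_numE.
have cov : [set` `]0%R, +oo[%R] = \bigcup_n `[(n.+2%:R : R)^-1, n.+2%:R]%classic.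
  apply/seteqP; split => [x /=|x [n _] /=]; rewrite !in_itv/= ?andbT.
    move=> x0.
    have [n hn] : exists n : nat, x + x^-1 <= n%:R.
      by exists (Num.truncn (x + x^-1)).+1; apply/ltW; rewrite truncnS_gt.
    have xV0 : 0 < x^-1 by rewrite invr_gt0.
    have n2 : (n%:R : R) <= n.+2%:R by rewrite ler_nat; apply: leq_trans (leqnSn _) (leqnSn _).
    exists n => //=; rewrite in_itv/=; apply/andP; split; last lra.
    by rewrite -[x]invrK lef_pV2 ?posrE//; lra.
  by move=> /andP[h _]; apply: lt_le_trans h; rewrite invr_gt0.
have := @integral_itv_exhaustion R (f (r - 1)) _ (fun n => (n.+2%:R : R)^-1) (fun n => n.+2%:R)
  (fun x => powR_expRN_ge0 _ _) (measurable_powR_expRN _) _ _ cov.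
move=> H; have {H} := H _ _.
rewrite -/(I _ _) => H.
have {}H : (I `[n.+2%:R^-1%R, n.+2%:R]%classic (r - 1)%R @[n --> \oo] --> I `]0%R, +oo[%classic (r - 1)%R)%E.
  apply: H.
  - apply/nonincreasing_seqP => n.
    by rewrite lef_pV2 ?posrE// ler_nat.
  - by apply/nondecreasing_seqP => n; rewrite ler_nat.
have step n : (r%:E * I `[n.+2%:R^-1%R, n.+2%:R]%classic (r - 1)%R
    <= I `]0%R, +oo[%classic r + (2 / n.+2%:R)%:E)%E.
  set p : R := _^-1; set q : R := n.+2%:R.
  have p0 : 0 < p by rewrite invr_gt0.
  have q1 : 1 < q by rewrite ltr1n.
  have pq : p < q by apply: lt_trans q1; rewrite invf_lt1 ?ltr0n ?ltr1n.
  have c1 : {within `[p, q], continuous (f (r - 1))} by exact: continuous_powR_expRN.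
  have c2 : {within `[p, q], continuous (f r)} by exact: continuous_powR_expRN.
  have c1r := within_continuousZ R _ _ r c1.
  have c3 : {within `[p, q], continuous (fun x => r * f (r - 1) x - f r x)}.
    have -> : (fun x => r * f (r - 1) x - f r x) = (fun x => r * f (r - 1) x + -1 * f r x).
      by apply/funext => x; rewrite mulN1r.
    by apply: within_continuousD => //; exact: within_continuousZ.
  have dF s : p <= s <= q -> is_derive s (1 : R) (f r) (r * f (r - 1) s - f r s).
    by move=> /andP[ps _]; apply: is_derive_powR_expRN; exact: lt_le_trans ps.
  rewrite /I -integralZl//=; last exact: integrable_itv.
  have -> : (\int[mu]_(x in `[p, q]) (r%:E * (f (r - 1)%R x)%:E) =
      \int[mu]_(x in `[p, q]) ((r * f (r - 1) x - f r x)%:E + (f r x)%:E))%E.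
    by apply: eq_integral => x _; rewrite -EFinM -EFinD subrK.
  rewrite integralD_EFin//=; [|exact: integrable_itv..].
  rewrite (integral_is_derive _ _ _ _ _ pq dF c3) addeC; apply: leeD.
    apply: ge0_subset_integral => //=.
    - by apply/measurable_EFinP/measurable_funTS; exact: measurable_powR_expRN.
    - by move=> x _; rewrite lee_fin powR_expRN_ge0.
    - move=> x /=; rewrite !in_itv/= andbT => /andP[px _]; exact: lt_le_trans px.
  rewrite lee_fin.
  have hq : f r q <= 2 / q.
    by have [_] := powR_expRN_bounds r q r01 (lt_trans ltr01 q1); apply; exact: ltW.
  have hp : 0 <= f r p := powR_expRN_ge0 r p.
  have -> : 2 * p = 2 / q by [].
  by apply: le_trans hq; rewrite lerBlDr lerDl.
(* On [1, 2] one has x^(r - 1) >= 1 / x >= 1 / 2 and exp(-x) >= exp(-2). *)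
have lo : (0 < I `]0%R, +oo[%classic (r - 1)%R)%E.
  apply: (@lt_le_trans _ _ (\int[mu]_(x in `[1%R, 2%R]) (2^-1 * expR (- 2))%:E)%E).
    rewrite integral_cst//= lebesgue_measure_itv/= lte_fin ltr1n.
    by rewrite -EFinB -EFinM lte_fin mulr_gt0 ?mulr_gt0 ?expR_gt0//; lra.
  apply: (@le_trans _ _ (I `[1%R, 2%R]%classic (r - 1)%R)).
    apply: ge0_le_integral => //=.
    - by apply/measurable_EFinP/measurable_funTS; exact: measurable_powR_expRN.
    - move=> x; rewrite in_itv/= => /andP[x1 x2]; rewrite lee_fin.
      apply: ler_pM; rewrite ?expR_ge0 ?ler_expR ?lerN2//.
      apply: (@le_trans _ _ (x `^ (- 1))); last by apply: ler_powR => //; lra.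
      by rewrite powR_inv1 ?lef_pV2 ?posrE//; lra.
  apply: ge0_subset_integral => //=.
  - by apply/measurable_EFinP/measurable_funTS; exact: measurable_powR_expRN.
  - by move=> x _; rewrite lee_fin powR_expRN_ge0.
  - by move=> x /=; rewrite !in_itv/= andbT => /andP[x1 _]; lra.
have up : (r%:E * I `]0%R, +oo[%classic (r - 1)%R <= I `]0%R, +oo[%classic r)%E.
  apply/lee_addgt0Pr => e e0.
  apply: cvge_le (cvgeZl _ H) => //.
  have : \forall n \near \oo, (2 / e : R) <= n%:R by exact: nbhs_infty_ger.
  apply: filterS => n hn; apply: le_trans (step n) _.
  rewrite leeD2l// lee_fin ler_pdivrMr// mulrC -ler_pdivrMr//.
  by apply: le_trans hn _; rewrite ler_nat; apply: leq_trans (leqnSn _) (leqnSn _).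
(* [Rintegral] sends an infinite integral to 0, so positivity of [GammaF r] also requires
   finiteness; it is inherited from exponent [r] through [up]. *)
have fin : I `]0%R, +oo[%classic (r - 1)%R \is a fin_num.
  rewrite ge0_fin_numE ?ltW//.
  move: up; case: (I _ (r - 1)) lo => [x _ _|_|//]; first exact: ltry.
  by rewrite gt0_muley ?lte_fin// leye_eq => /eqP E; move: Joo; rewrite E.
apply/andP; split.
  by rewrite mulr_gt0// /GammaF /Rintegral fine_gt0// lo/= ltey_eq fin.
rewrite -lee_fin EFinM /GammaF /Rintegral fineK// fineK; first by rewrite addrK.
by rewrite addrK.
Qed.
End GammaFunction.

(** * Inequalities between real numbers: the ratio condition, the double well, and linear
    balances *)

Section ScalarInequalities.
Variable R : realType.
Implicit Types (al r th a b x : R).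

(** [S] is the square root in the equation of r_star. Since 3 + 2 S >= 3, r^2 (1 + r) <= 1/3 and
    hence r <= 1/2; the radicand increases with r, and its value at r = 1/2 is the stated bound on
    S^2. This gives S <= 1, so r^2 (1 + r) >= 1/5, which exceeds 4/27, the value at r = 1/3. *)
Lemma rstar_bounds al r : 0 < al < 1 -> 0 < r -> rstar_eq al r = 0 ->
  exists S, [/\ 0 <= S, S <= 1, 1 / (r ^+ 2 * (1 + r)) = 3 + 2 * S,
    S ^+ 2 <= 2 / 3 * (1 - al / 2) / (1 + al / 2) + 1 / 3 & 1 / 3 <= r].
Proof.
move=> /andP[al0 al1] r0; rewrite /rstar_eq; set c := _ + r / (1 + r) => E.
have p1 : 0 < 1 + r by lra.
have p2 : 0 < 1 + al / 2 by lra.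
have p3 : 0 < 1 + al + (1 - al / 2) * r by nra.
have c0 : 0 <= c.
  rewrite /c addr_ge0// divr_ge0 ?(ltW p1) ?(ltW r0)//; nra.
have S0 := sqrtr_ge0 c; have S2 := sqr_sqrtr c0; move: E S0 S2.
set S := Num.sqrt c => E S0 S2.
have q0 : 0 < r ^+ 2 * (1 + r) by rewrite mulr_gt0 ?exprn_gt0.
have E1 : 1 / (r ^+ 2 * (1 + r)) = 3 + 2 * S by lra.
have E2 : 1 = (3 + 2 * S) * (r ^+ 2 * (1 + r)) by rewrite -E1 divfK ?gt_eqF.
have r2 : r <= 1 / 2.
  rewrite leNgt; apply/negP => h.
  have h2 : 1 / 4 < r ^+ 2 by nra.
  have h3 : 3 / 8 < r ^+ 2 * (1 + r) by nra.
  nra.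
have cle : c <= 2 / 3 * (1 - al / 2) / (1 + al / 2) + 1 / 3.
  rewrite /c; apply: lerD; last by rewrite ler_pdivrMr//; lra.
  rewrite ler_pdivrMr// [leRHS]mulrAC ler_pdivlMr//.
  have -> : 2 * (1 - al / 2) * r * (1 + al / 2) = (1 - al / 2) * (2 * r * (1 + al / 2)) by ring.
  have -> : 2 / 3 * (1 - al / 2) * (1 + al + (1 - al / 2) * r) =
    (1 - al / 2) * (2 / 3 * (1 + al + (1 - al / 2) * r)) by ring.
  apply: ler_wpM2l; [lra|nra].
have c1 : c <= 1.
  apply: le_trans cle _.
  suff : 2 / 3 * (1 - al / 2) / (1 + al / 2) <= 2 / 3 by lra.
  by rewrite ler_pdivrMr//; lra.
have S1 : S <= 1 by nra.
exists S; split => //; first by rewrite S2.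
rewrite leNgt; apply/negP => h.
have h2 : r ^+ 2 < 1 / 9 by nra.
have h3 : r ^+ 2 * (1 + r) < 4 / 27 by nra.
nra.
Qed.

Lemma rstar_ratio r x S : 0 < r -> 1 / (r ^+ 2 * (1 + r)) = 3 + 2 * S -> r <= x ->
  1 / (x ^+ 2 * (1 + x)) <= 3 + 2 * S.
Proof.
move=> r0 <- rx; rewrite !div1r lef_pV2 ?posrE ?mulr_gt0 ?exprn_gt0//; try lra.
by apply: ler_pM; [nra|lra|nra|lra].
Qed.

Lemma boundary_coef al S z : 0 < al < 1 ->
  S ^+ 2 <= 2 / 3 * (1 - al / 2) / (1 + al / 2) + 1 / 3 -> 1 / 3 <= z ->
  al / (1 + z) + S ^+ 2 * al / (6 * (1 - al / 2)) <= 1.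
Proof.
move=> /andP[al0 al1] hS hz.
have p1 : 0 < 1 + al / 2 by lra.
have p2 : 0 < 1 - al / 2 by lra.
have p3 : 0 < 6 * (1 - al / 2) by lra.
have h1 : al / (1 + z) <= 3 / 4 by rewrite ler_pdivrMr; lra.
suff : S ^+ 2 * al / (6 * (1 - al / 2)) <= 1 / 4 by lra.
rewrite ler_pdivrMr//.
have h2 : 2 / 3 * (1 - al / 2) / (1 + al / 2) <= 2 / 3 * (1 - al / 2).
  by rewrite ler_pdivrMr//; nra.
nra.
Qed.

(** For [al] >= 2/5 the hypothesis gives S^2 <= 7/9. At [al] = 2/5 the two sides are then 7/15 and
    12/25, so the inequality holds with little room; the same threshold, theta = 1/5, separates the
    two cases of [double_well_increment]. *)
Lemma first_kernel_coef al S : 2 / 5 <= al < 1 ->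
  S ^+ 2 <= 2 / 3 * (1 - al / 2) / (1 + al / 2) + 1 / 3 ->
  S ^+ 2 * (1 - al) <= 3 / 2 * al * (1 - al / 2).
Proof.
move=> /andP[al0 al1] hS.
have p1 : 0 < 1 + al / 2 by lra.
have h2 : 2 / 3 * (1 - al / 2) / (1 + al / 2) <= 4 / 9.
  by rewrite ler_pdivrMr//; lra.
nra.
Qed.

(** The difference of the two sides is (b - a)^2 times a quadratic in a and b. Completing the square
    in b leaves a remainder in a alone, whose a^2 coefficient is nonnegative for th <= 1/5.
    Otherwise the remainder is checked at a^2 = 4, where it equals (1/2 - th) (7 - 8 th). *)
Lemma double_well_increment th a b : 0 < th < 1 / 2 -> th <= 1 / 5 \/ `|a| <= 2 ->
  FAC b - FAC a <= (th * fAC a + (1 - th) * fAC b) * (b - a) + (b - a) ^+ 2.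
Proof.
move=> /andP[th0 th1] hyp; rewrite -subr_ge0 /FAC /fAC.
set E := (X in 0 <= X).
have -> : E = (b - a) ^+ 2 *
    (1 - (1 - 2 * th) * (1 / 2 - (a ^+ 2 + 2 * a * b + 3 * b ^+ 2) / 4) - th * (a ^+ 2 - b ^+ 2) / 2).
  by rewrite /E; field.
apply: mulr_ge0; first exact: sqr_ge0.
(* Multiplying by 3 - 4 th, the coefficient of b^2 up to a factor 4, makes the completed square free
   of fractions in th. *)
have p : 0 < 3 - 4 * th by lra.
suff : 0 <= (3 - 4 * th) * (1 - (1 - 2 * th) * (1 / 2 - (a ^+ 2 + 2 * a * b + 3 * b ^+ 2) / 4) - th * (a ^+ 2 - b ^+ 2) / 2) by rewrite pmulr_rge0.
have -> : (3 - 4 * th) * (1 - (1 - 2 * th) * (1 / 2 - (a ^+ 2 + 2 * a * b + 3 * b ^+ 2) / 4) - th * (a ^+ 2 - b ^+ 2) / 2) =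
  ((3 - 4 * th) * b + (1 - 2 * th) * a) ^+ 2 / 4 + (3 - 4 * th) * (1 / 2 + th)
   + (2 - 12 * th + 12 * th ^+ 2) * a ^+ 2 / 4.
  by field.
have s1 := sqr_ge0 ((3 - 4 * th) * b + (1 - 2 * th) * a).
suff : 0 <= (3 - 4 * th) * (1 / 2 + th) + (2 - 12 * th + 12 * th ^+ 2) * a ^+ 2 / 4 by lra.
case: hyp => [h|].
  have : 0 <= 2 - 12 * th + 12 * th ^+ 2 by nra.
  have := sqr_ge0 a; nra.
rewrite ler_norml => /andP[a1 a2].
have a4 : a ^+ 2 <= 4 by nra.
have := sqr_ge0 a.
have [h|h] := leP 0 (2 - 12 * th + 12 * th ^+ 2); nra.
Qed.

(** On [-2, 2] the reaction is at least -6, the opposite of its value at 2. As th < 1/2, the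
    implicit share (1 - th) 6 dominates the explicit share th 6. *)
Lemma relaxed_bound_coef th d x : 0 < th < 1 / 2 -> 0 <= d -> `|x| <= 2 ->
  0 <= (2 - x) * d + th * fAC x + (1 - th) * fAC 2.
Proof.
move=> /andP[th0 th1] d0; rewrite ler_norml => /andP[x1 x2]; rewrite /fAC.
have h1 : 0 <= (2 - x) * d by apply: mulr_ge0 => //; lra.
have h2 : -6 <= x ^+ 3 - x.
  have -> : x ^+ 3 - x = (x + 2) * ((x - 1) ^+ 2 + 2) - 6 by ring.
  have := sqr_ge0 (x - 1); nra.
nra.
Qed.
(** Arithmetic of [ahat_step_diag]. There [gm] and [gn] are the kernels of levels m and m + 1 at
    t_{m-1}; [zm], [zn] and [mG] are moments on the interval before t_{m-1}, [mn] and [tn] moments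
    of the newer kernel on the one after. The deficit S^2 D tm / 6 is converted into a multiple of
    [gm], and [coef] says that the resulting costs fit into one copy of [gm]. *)
Lemma boundary_balance S al y z D tm gm gn mG Z mn tn zm zn :
  0 < al < 1 -> 0 < y -> 0 < 1 + z ->
  - (S ^+ 2 / 6 * D * tm) <= gm - gn - mG + (zm - zn) / y - Z ->
  mn - tn / (1 + z) <= gm + gn * (al / (1 + z)) - (gm - gn) ->
  D * ((1 - al / 2) * tm) <= al * gm -> 0 <= zm ->
  al / (1 + z) + S ^+ 2 * al / (6 * (1 - al / 2)) <= 1 -> gn <= gm -> 0 <= gm ->
  mG + Z - (zm - zn) / (1 + y) <=
  2 * (gm + zm / (y * (1 + y))) - (mn + zn / (y * (1 + y)) - tn / (1 + z)).
Proof.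
move=> /andP[al0 al1] y0 z0 hb hl hD zm0 coef g12 gm0.
have q0 : 0 < 1 - al / 2 by lra.
have e1 : (zm - zn) / y = (zm - zn) / (1 + y) + zm / (y * (1 + y)) - zn / (y * (1 + y)).
  by field; rewrite !gt_eqF//; lra.
have h1 : 0 <= zm / (y * (1 + y)) by rewrite divr_ge0// mulr_ge0//; lra.
have h2 : gn * (al / (1 + z)) <= gm * (al / (1 + z)).
  by apply: ler_wpM2r => //; rewrite divr_ge0// ltW.
have h3 : S ^+ 2 / 6 * D * tm <= gm * (S ^+ 2 * al / (6 * (1 - al / 2))).
  have -> : S ^+ 2 / 6 * D * tm = S ^+ 2 / (6 * (1 - al / 2)) * (D * ((1 - al / 2) * tm)).
    by field; rewrite gt_eqF//; lra.
  have -> : gm * (S ^+ 2 * al / (6 * (1 - al / 2))) = S ^+ 2 / (6 * (1 - al / 2)) * (al * gm).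
    by ring.
  by apply: ler_wpM2l => //; rewrite divr_ge0 ?sqr_ge0//; lra.
have h4 : gm * (al / (1 + z) + S ^+ 2 * al / (6 * (1 - al / 2))) <= gm * 1.
  exact: ler_wpM2l.
rewrite mulrDr mulr1 in h4.
lra.
Qed.

(** Arithmetic of [ahat_diag_gap]: here the deficit is paid by (1 - al / 2) a0 - gm, which is
    positive because a0 and gm are proportional. *)
Lemma first_balance S al y a0 D tm gm mG Z zm :
  2 / 5 <= al < 1 -> 0 < y ->
  - (S ^+ 2 / 6 * D * tm) <= gm - mG + zm / y - Z ->
  D * ((1 - al / 2) * tm) <= al * gm ->
  (1 - al) * a0 = (1 - al / 2) * gm ->
  S ^+ 2 * (1 - al) <= 3 / 2 * al * (1 - al / 2) -> 0 <= gm ->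
  mG + Z - zm / (1 + y) + al / 2 * a0 <= a0 + zm / (y * (1 + y)).
Proof.
move=> /andP[al0 al1] y0 hb hD ha coef gm0.
have q0 : 0 < 1 - al / 2 by lra.
have e1 : zm / y = zm / (1 + y) + zm / (y * (1 + y)).
  by field; rewrite !gt_eqF//; lra.
have p0 : 0 < 1 - al by lra.
have gE : gm = (1 - al) * a0 / (1 - al / 2) by rewrite ha mulrAC divff ?mul1r// gt_eqF.
have a00 : 0 <= a0 by rewrite -(pmulr_rge0 _ p0) ha mulr_ge0// ltW.
have h3 : S ^+ 2 / 6 * D * tm <= S ^+ 2 / (6 * (1 - al / 2)) * (al * gm).
  have -> : S ^+ 2 / 6 * D * tm = S ^+ 2 / (6 * (1 - al / 2)) * (D * ((1 - al / 2) * tm)).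
    by field; rewrite gt_eqF//; lra.
  by apply: ler_wpM2l => //; rewrite divr_ge0 ?sqr_ge0//; lra.
have h4 : S ^+ 2 / (6 * (1 - al / 2)) * (al * gm) <= (1 - al / 2) * a0 - gm.
  rewrite gE.
  have -> : S ^+ 2 / (6 * (1 - al / 2)) * (al * ((1 - al) * a0 / (1 - al / 2))) =
    a0 * (al / 6) * (S ^+ 2 * (1 - al)) / ((1 - al / 2) ^+ 2).
    by field; rewrite gt_eqF//; lra.
  have -> : (1 - al / 2) * a0 - (1 - al) * a0 / (1 - al / 2) =
    a0 * (al / 6) * (3 / 2 * al * (1 - al / 2)) / ((1 - al / 2) ^+ 2).
    by field; rewrite gt_eqF//; lra.
  rewrite ler_pM2r ?invr_gt0 ?exprn_gt0//.
  by apply: ler_wpM2l => //; rewrite mulr_ge0//; lra.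
lra.
Qed.
Lemma delay_balance_first (c a0 K x y : R) :
  c * (K - x) <= a0 * (K - x) -> c * (K - x) + a0 * (y - K) <= a0 * (y - x).
Proof. lra. Qed.

Lemma delay_balance (c b B K x y s : R) :
  (b + c) * (K - x) <= B * (K - x) -> - (b * (K - x)) <= s ->
  c * (K - x) + B * (y - K) <= B * (y - x) + s.
Proof. lra. Qed.

Lemma max_point_balance (d fx f2 fy q l1 l2 b : R) :
  0 <= d - q + fx + f2 -> f2 < fy -> l1 <= q -> l2 <= 0 -> 0 <= b ->
  ~ (d + b <= - (fx + fy - (l1 + l2))).
Proof. lra. Qed.

(** The scheme tested with the increment [W]: [Y] is the convolution sum, [f] the reaction, [l] the
    diffusion. Of the term 2 c W^2, one half absorbs the W^2 produced by the double well, since c is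
    at least one where W is nonzero, and the other half stays as dissipation. *)
Lemma energy_balance (W Y f c dG dF l : R) :
  dG <= 2 * W * Y -> 2 * c * W + Y = - (f - l) ->
  dF <= f * W + W ^+ 2 -> 1 * (W * W) <= c * (W * W) ->
  dG / 2 + dF + c * (W * W) <= l * W.
Proof.
move=> gs sch nl sq.
have YW : 2 * W * Y = 2 * (l * W) - 2 * (f * W) - 4 * (c * (W * W)).
  have -> : Y = - (f - l) - 2 * c * W by rewrite -sch; ring.
  by ring.
rewrite YW in gs; rewrite expr2 in nl; lra.
Qed.

Lemma total_balance (a b g s : R) : s <= a -> a <= b * (- (1 / 2) * g) -> b * (1 / 2 * g) + s <= 0.
Proof. lra. Qed.
End ScalarInequalities.

(** * Moment estimates for convex increasing kernels *)

Section PowerKernel.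
Variables (R : realType) (C k T T' al : R).
Hypotheses (C0 : 0 <= C) (k01 : 0 <= k <= 1) (TT' : T <= T') (al0 : 0 <= al).
Implicit Types (a b c s S y Z l : R).

Definition pker s : R := C * powdiff R k T T' al s.
(** The derivative of [pker]; being nonnegative and nondecreasing, it makes [pker] increasing and
    convex. *)
Definition dpker s : R := C * (al * powdiff R k T T' (al + 1) s).

Lemma pker_ge0 s : s < T -> 0 <= pker s.
Proof. by move=> sT; rewrite mulr_ge0//; exact: powdiff_ge0. Qed.

Lemma dpker_ge0 s : s < T -> 0 <= dpker s.
Proof.
move=> sT; do 2 apply: mulr_ge0 => //.
by apply: powdiff_ge0 => //; exact: addr_ge0.
Qed.

Lemma dpker_mono a b : a <= b -> b < T -> dpker a <= dpker b.
Proof.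
move=> ab bT; rewrite ler_wpM2l// ler_wpM2l//.
by apply: powdiff_mono => //; exact: addr_ge0.
Qed.

Lemma pker_continuous a b : b < T -> {within `[a, b], continuous pker}.
Proof. by move=> bT; apply: within_continuousZ; exact: powdiff_continuous. Qed.

Lemma pker_slope_le a b : b < T -> forall x y, a <= x -> x <= y -> y <= b ->
  pker x - dpker a * x <= pker y - dpker a * y.
Proof.
move=> bT x y ax xy yb.
have := powdiff_slope_le R k T T' al a x y al0 k01 ax xy (le_lt_trans yb bT) TT'.
by rewrite -!(mulrA C) -!mulrBr => h; exact: ler_wpM2l.
Qed.

Lemma pker_slope_ge a b : b < T -> forall x y, a <= x -> x <= y -> y <= b ->
  dpker b * x - pker x <= dpker b * y - pker y.
Proof.
move=> bT x y ax xy yb.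
have := powdiff_slope_ge R k T T' al b x y al0 k01 xy yb bT TT'.
by rewrite -!(mulrA C) -!mulrBr => h; exact: ler_wpM2l.
Qed.

Lemma pker_mono a b : a <= b -> b < T -> pker a <= pker b.
Proof. by move=> ab bT; rewrite ler_wpM2l//; exact: powdiff_mono. Qed.

Lemma tilt_pker_ge0 a b : a < b -> b < T -> 0 <= tilt R pker a b.
Proof.
move=> ab bT; have := tilt_slope_ge R pker a b 0 ab (pker_continuous a b bT).
rewrite !mul0r; apply => x y _ xy yb; rewrite !mul0r !subr0.
by apply: pker_mono => //; exact: le_lt_trans bT.
Qed.

Lemma mean_sub_tilt_ge0 a b l : a < b -> b < T -> 0 <= l <= 1 ->
  0 <= mean R pker a b - l * tilt R pker a b.
Proof.
move=> ab bT l01.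
have slope x y : a <= x -> x <= y -> y <= b -> pker x - 0 * x <= pker y - 0 * y.
  move=> _ xy yb; rewrite !mul0r !subr0.
  by apply: pker_mono => //; exact: le_lt_trans bT.
have := mean_tilt_slope_ge R pker a b 0 ab (pker_continuous a b bT) slope l l01.
rewrite !mul0r addr0; apply: le_trans.
by apply: pker_ge0; exact: lt_trans bT.
Qed.

(** To the left of [a] the slope is at most D = [dpker a], so the tilt is at most D (a - a0) / 6.
    Writing a - a0 = (b - a) / x produces the factor 1 / (x^2 (1 + x)), which r_star controls. *)
Lemma tilt_previous_le a0 a b S : a0 < a -> a < b -> a < T ->
  let x := (b - a) / (a - a0) in 1 / (x ^+ 2 * (1 + x)) <= 3 + 2 * S ->
  tilt R pker a0 a / (x * (1 + x)) <= dpker a * (b - a) / 6 * (3 + 2 * S).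
Proof.
move=> a0a ab aT x hx.
have x0 : 0 < x by rewrite divr_gt0// subr_gt0.
have x1 : 0 < 1 + x by lra.
have d0 := dpker_ge0 a aT.
have := tilt_slope_le R pker a0 a (dpker a) a0a (pker_continuous a0 a aT) (pker_slope_ge a0 a aT).
move=> h; rewrite ler_pdivrMr; last exact: mulr_gt0.
apply: le_trans h _.
have xe : b - a = x * (a - a0) by rewrite /x divfK// gt_eqF// subr_gt0.
have {}hx : 1 <= (3 + 2 * S) * (x ^+ 2 * (1 + x)).
  by rewrite -ler_pdivrMr// mulr_gt0// exprn_gt0.
rewrite xe -subr_ge0.
have -> : dpker a * (x * (a - a0)) / 6 * (3 + 2 * S) * (x * (1 + x)) - dpker a * (a - a0) / 6
  = dpker a * (a - a0) / 6 * ((3 + 2 * S) * (x ^+ 2 * (1 + x)) - 1) by ring.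
by rewrite mulr_ge0 ?subr_ge0// divr_ge0// mulr_ge0// subr_ge0 ltW.
Qed.

(* AM-GM: [1 / y - 2 S + S^2 y >= 0] *)
Lemma kernel_brace_ge a b y S Z : a < b -> b < T -> 0 < y ->
  Z <= dpker a * (b - a) / 6 * (3 + 2 * S) ->
  - (S ^+ 2 / 6 * dpker a * (y * (b - a))) <=
  pker b - mean R pker a b + tilt R pker a b / y - Z.
Proof.
move=> ab bT y0 hZ.
have cf := pker_continuous a b bT.
have h1 := mean_slope_le R pker a b (dpker a) ab cf (pker_slope_le a b bT).
have h2 := tilt_slope_ge R pker a b (dpker a) ab cf (pker_slope_le a b bT).
have d0 := dpker_ge0 a (lt_trans ab bT).
have h3 : dpker a * (b - a) / 6 / y <= tilt R pker a b / y by rewrite ler_pM2r ?invr_gt0.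
have h4 : 0 <= dpker a * (b - a) / 6 * ((1 - S * y) ^+ 2 / y).
  apply: mulr_ge0; last by apply: divr_ge0; [exact: sqr_ge0|exact: ltW].
  by apply: divr_ge0 => //; apply: mulr_ge0 => //; rewrite subr_ge0 ltW.
have h5 : dpker a * (b - a) / 6 * ((1 - S * y) ^+ 2 / y) =
  dpker a * (b - a) / 6 / y - dpker a * (b - a) / 6 * (2 * S) + S ^+ 2 / 6 * dpker a * (y * (b - a)).
  by field; rewrite gt_eqF.
lra.
Qed.

(** The deficit of [kernel_brace_ge] is at most D (c - b) / 6 because S <= 1, with D the slope at
    [a]. Moving on to the mean over [b, c] gains at least D (c - b) / 3, since the slope at [b] is
    no smaller and l <= 1. *)
Lemma kernel_step_ge0 a b c y S Z l : a < b -> b < c -> c < T -> 0 < y ->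
  c - b = y * (b - a) -> 0 <= S <= 1 -> 0 <= l <= 1 ->
  Z <= dpker a * (b - a) / 6 * (3 + 2 * S) ->
  0 <= mean R pker b c - l * tilt R pker b c - mean R pker a b + tilt R pker a b / y - Z.
Proof.
move=> ab bc cT y0 yE /andP[S0 S1] l01 hZ.
have bT := lt_trans bc cT.
have h1 := kernel_brace_ge a b y S Z ab bT y0 hZ.
have h2 := mean_tilt_slope_ge R pker b c (dpker b) bc (pker_continuous b c cT)
  (pker_slope_le b c cT) l l01.
rewrite -yE in h1.
have d1 := dpker_mono a b (ltW ab) bT.
have d0 := dpker_ge0 a (lt_trans ab bT).
have cb : 0 < c - b by rewrite subr_gt0.
have h3 : dpker a * (c - b) <= dpker b * (c - b) by rewrite ler_pM2r.
have h4 : 0 <= dpker a * (c - b) by rewrite mulr_ge0// ltW.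
have h5 : S ^+ 2 / 6 * dpker a * (c - b) <= 1 / 6 * (dpker a * (c - b)).
  rewrite -mulrA; apply: ler_wpM2r => //; nra.
have h6 : dpker b * (c - b) * (1 / 3) <= dpker b * (c - b) * (1 / 2 - l / 6).
  apply: ler_wpM2l; first lra.
  by move/andP: l01 => [_ l1]; lra.
lra.
Qed.
End PowerKernel.

(** * An upper moment bound next to the singularity *)

Section PowerMoment.
Variable R : realType.

(** The right side is the tangent at q = 1 of a concave power. *)
Lemma powR_onem_le (al q : R) : 0 < al < 1 -> 0 < q <= 1 ->
  q `^ (1 - al) <= (1 - al) * q + al.
Proof.
move=> /andP[al0 al1] /andP[q0 q1].
have df s : q <= s <= 1 -> is_derive s (1 : R) (fun x : R => x `^ (1 - al) - (1 - al) * x)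
   ((1 - al) * (s `^ (1 - al - 1) - 1)).
  move=> /andP[qs _].
  have h1 : is_derive s (1 : R) (fun v : R => v `^ (1 - al)) ((1 - al) * s `^ (1 - al - 1)).
    by apply: is_derive1_powR; exact: lt_le_trans qs.
  have h2 := is_deriveZ (1 - al) (is_derive_id s (1 : R)).
  apply: is_derive_eq (is_deriveB h1 h2) _.
  by rewrite /GRing.scale/= mulr1 mulrBr mulr1.
have one : 1 `^ (1 - al) = 1 :> R by rewrite powR1.
have := ndecr_is_derive R _ _ q 1 q1 df; rewrite one => h.
suff : q `^ (1 - al) - (1 - al) * q <= 1 - (1 - al) * 1 by lra.
apply: h => s /andP[qs s1]; apply: mulr_ge0; first lra.
have -> : 1 - al - 1 = - al by ring.
have s0 : 0 < s := lt_le_trans q0 qs.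
rewrite subr_ge0 powRN invf_ge1 ?powR_gt0//.
have <- : 1 `^ al = 1 :> R by rewrite powR1.
by apply: ge0_ler_powR; rewrite ?nnegrE; lra.
Qed.

(** Condition z (b - a) / 2 <= T - b makes the weight of mean - tilt / (1 + z) at most a multiple of
    T - s. That factor tames the singularity: (T - s) (f s - f a) <= al (s - a) f a, by the tangent
    bound of [powR_onem_le] with q = (T - s) / (T - a). *)
Lemma last_moment_le (C T al a b z : R) : 0 <= C -> 0 < al < 1 -> a < b -> b < T ->
  0 < z -> z / 2 * (b - a) <= T - b ->
  mean R (pker R C 0 T T al) a b - 1 / (1 + z) * tilt R (pker R C 0 T T al) a b
  <= pker R C 0 T T al a * (1 + al / (1 + z)).
Proof.
move=> C0 al01 ab bT z0 hz; set f := pker _ _ _ _ _ _; have /andP[al0 al1] := al01.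
have fE s : f s = C * (T - s) `^ (- al) by rewrite /f /pker /powdiff mul0r subr0.
have ba : 0 < b - a by rewrite subr_gt0.
have z1 : 0 < 1 + z by lra.
have f0 : 0 <= f a by rewrite fE mulr_ge0// powR_ge0.
have cf : {within `[a, b], continuous f} by exact: pker_continuous.
set l := 1 / (1 + z).
have := weighted_moment_le R f a b 1 (- l) (f a * (1 + al / (1 + z)))
  (f a * (2 * al / ((b - a) * (1 + z)) - 2 / ((1 + z) * (b - a)))) 0 ab cf.
rewrite mul0r mul0r addr0 mul1r mulNr; apply => s /andP[sa sb].
rewrite mul0r addr0.
set m := (a + b) / 2.
have sT : 0 < T - s by rewrite subr_gt0; exact: le_lt_trans bT.
have aT : 0 < T - a by lra.
have [q [q01 Tsq]] : exists q, 0 < q <= 1 /\ T - s = q * (T - a).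
  exists ((T - s) / (T - a)); rewrite divfK ?gt_eqF//.
  by rewrite divr_gt0//= ler_pdivrMr//; split=> //; lra.
have key : (T - s) * (f s - f a) <= al * (s - a) * f a.
  have := powR_onem_le al q al01 q01.
  have /andP[q0 q1] := q01.
  rewrite !fE {2}Tsq (@powRM _ q (T - a) _ (ltW q0) (ltW aT)).
  have -> : q `^ (1 - al) = q * q `^ (- al).
    rewrite powRD ?powRr1//; first exact: ltW.
    by apply/implyP => _; rewrite gt_eqF.
  set P := (T - a) `^ (- al); set u := q `^ (- al) => hu.
  have P0 : 0 <= P := powR_ge0 _ _.
  have -> : s - a = (1 - q) * (T - a) by rewrite mulrBl -Tsq; ring.
  rewrite Tsq -subr_ge0.
  have -> : al * ((1 - q) * (T - a)) * (C * P) - q * (T - a) * (C * (u * P) - C * P)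
    = C * P * (T - a) * ((1 - al) * q + al - q * u) by ring.
  apply: mulr_ge0; last by rewrite subr_ge0.
  by apply: mulr_ge0; [exact: mulr_ge0|exact: ltW].
have ffs : f a <= f s.
  by apply: pker_mono => //; [lra|exact: ltW|exact: le_lt_trans bT].
have wle : 1 + - l * (2 * (s - m) / (b - a)) <=
    2 * (T - s) / ((b - a) * (1 + z)).
  rewrite ler_pdivlMr ?mulr_gt0//.
  have -> : (1 + - l * (2 * (s - m) / (b - a))) * ((b - a) * (1 + z)) =
    (b - a) * (1 + z) - 2 * (s - m) by rewrite /l; field; rewrite !gt_eqF.
  rewrite /m; lra.
have := ler_wpM2r (_ : 0 <= f s - f a) wle; rewrite subr_ge0 => /(_ ffs) h.
have : 2 * (T - s) / ((b - a) * (1 + z)) * (f s - f a) <=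
    2 * (al * (s - a) * f a) / ((b - a) * (1 + z)).
  rewrite mulrAC ler_pM2r ?invr_gt0 ?mulr_gt0//.
  by rewrite -[leLHS]mulrA ler_pM2l.
move=> /(le_trans h); rewrite mulrBr lerBlDr => /le_trans; apply.
rewrite le_eqVlt; apply/orP; left; apply/eqP.
by rewrite /m /l; field; rewrite !gt_eqF.
Qed.
End PowerMoment.

(* [lia] restricted to hypotheses on natural numbers: preprocessing the
   real-valued ones is very slow *)
Ltac nat_lia :=
  repeat match goal with
  | H : ?P |- _ =>
    lazymatch type of P with
    | Prop =>
      lazymatch P with
      | is_true (leq _ _) => fail
      | is_true (leq _ _ && leq _ _) => fail
      | is_true (@negb _) => fail
      | @eq nat _ _ => fail
      | _ => clear H
      end
    end
  end; lia.

(** * The discrete kernels on the nonuniform mesh *)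

Section MeshKernels.
Variables (R : realType) (al rs S : R) (N : nat) (t : nat -> R).
Hypotheses (al01 : 0 < al < 1)
  (tinc : forall k, (k < N)%N -> t k < t k.+1).
Hypotheses (rs_ge : 1 / 3 <= rs) (S01 : 0 <= S <= 1)
  (rsS : 1 / (rs ^+ 2 * (1 + rs)) = 3 + 2 * S)
  (hr : forall k, (2 <= k <= N)%N -> rs <= mratio t k)
  (hS : S ^+ 2 <= 2 / 3 * (1 - al / 2) / (1 + al / 2) + 1 / 3).
Notation th := (al / 2).
Notation T := (tsig t th).
Notation g := (varpi t al th).
Notation tau := (mtau t).
Notation X n k := (ahat t al th n (n - k)).
Let C : R := (GammaF (1 - al))^-1.

Let al0 : 0 < al. Proof. by case/andP: al01. Qed.
Let al1 : al < 1. Proof. by case/andP: al01. Qed.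
Let th1 : 0 < 1 - th. Proof. by have := al1; have := al0; lra. Qed.

Lemma Gamma_onem_gt0 : 0 < GammaF (1 - al).
Proof.
have r01 : 0 < 1 - al < 1 by rewrite subr_gt0 al1 gtrBl al0.
have /andP[h _] := Gamma_succ_ge R (1 - al) r01.
by move: h; rewrite pmulr_rgt0// subr_gt0.
Qed.

Let C0 : 0 <= C. Proof. by rewrite invr_ge0 ltW// Gamma_onem_gt0. Qed.

Lemma mesh_le i j : (i <= j)%N -> (j <= N)%N -> t i <= t j.
Proof.
move=> + jN; elim: j jN => [|j IH] jN; first by rewrite leqn0 => /eqP ->.
rewrite leq_eqVlt => /orP[/eqP -> //|ij].
by apply: le_trans (IH (ltnW jN) ij) _; exact/ltW/tinc.
Qed.

Lemma mtau_gt0 k : (0 < k <= N)%N -> 0 < tau k.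
Proof. by case: k => // k /andP[_ kN]; rewrite subr_gt0; exact: tinc. Qed.

Lemma mesh_pred_lt k : (0 < k <= N)%N -> t k.-1 < t k.
Proof. by move=> /mtau_gt0; rewrite subr_gt0. Qed.

Lemma tsig_sub n : T n - t n.-1 = (1 - th) * tau n.
Proof. by rewrite /tsig /mtau; ring. Qed.

Lemma mesh_lt_tsig j n : (j < n)%N -> (n <= N)%N -> t j < T n.
Proof.
move=> jn nN; have n0 : (0 < n <= N)%N by rewrite (leq_ltn_trans _ jn).
have h : t j <= t n.-1.
  by apply: mesh_le; [case: n jn {nN n0}|exact: leq_trans (leq_pred _) nN].
have := mtau_gt0 _ n0; have := tsig_sub n; have := al0; have := al1; nra.
Qed.

Lemma tsig_lt_mesh n : (0 < n <= N)%N -> T n < t n.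
Proof. by move=> /mtau_gt0; rewrite /tsig /mtau; have := al0; nra. Qed.

Lemma tsig_le m n : (0 < m)%N -> (m <= n)%N -> (n <= N)%N -> T m <= T n.
Proof.
move=> m0; rewrite leq_eqVlt => /orP[/eqP -> //|mn] nN.
have mN : (0 < m <= N)%N by rewrite m0 (leq_trans (ltnW mn)).
by apply: ltW; apply: lt_trans (tsig_lt_mesh m mN) (mesh_lt_tsig m n mn nN).
Qed.

Lemma varpi_pker k m n : (fun s => g m s - k * g n s) = pker R C k (T m) (T n) al.
Proof.
apply/funext => s; rewrite /varpi /omegaF /pker /powdiff -/C.
have -> : 1 - al - 1 = - al by ring.
by ring.
Qed.

Lemma varpi_pker0 n : g n = pker R C 0 (T n) (T n) al.
Proof. by rewrite -varpi_pker; apply/funext => s; rewrite mul0r subr0. Qed.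

Lemma mratio_ge_third k : (2 <= k <= N)%N -> 1 / 3 <= mratio t k.
Proof. by move=> /hr; apply: le_trans. Qed.

Lemma mtauS k : (0 < k)%N -> (k < N)%N -> tau k.+1 = mratio t k.+1 * tau k.
Proof.
by move=> k0 kN; rewrite /mratio /= divfK// gt_eqF// mtau_gt0// k0 ltnW.
Qed.

Lemma akern_mean n k : (0 < k < n)%N -> (n <= N)%N ->
  akern t al th n (n - k) = mean R (g n) (t k.-1) (t k).
Proof.
move=> /andP[k0 kn] nN; rewrite /akern subKn ?(ltnW kn)//.
by rewrite min_l// ltW//; exact: mesh_lt_tsig.
Qed.

Lemma zeta_tilt n k : (k <= n)%N ->
  zeta t al th n (n - k) = tilt R (g n) (t k.-1) (t k).
Proof. by move=> kn; rewrite /zeta subKn. Qed.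

(** This is the index k = 0: since [0.-1] is 0 its interval is a point and its step is 0. Hence the
    formula for interior columns also covers k = 1, where the definition of [ahat] has no such
    term. *)
Lemma zeta_first n : zeta t al th n n = 0.
Proof. by rewrite /zeta subnn /mtau /= subrr expr0n /= invr0 mulr0 mul0r. Qed.

Lemma ahat_interior n k : (0 < k < n)%N -> (n <= N)%N ->
  X n k = akern t al th n (n - k)
    + zeta t al th n (n - k.-1) / (mratio t k * (1 + mratio t k))
    - zeta t al th n (n - k) / (1 + mratio t k.+1).
Proof.
move=> /andP[k0 kn] nN; rewrite /ahat.
have -> : (n == 0%N) = false by case: n kn {nN}.
have -> : (n == 1%N) = false by case: n kn nN => [|[|n]]//; case: k k0.
have -> : (n - k == 0)%N = false by apply/negbTE; rewrite subn_eq0 -ltnNge.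
have [h|h] := ltnP (n - k) n.-1.
  rewrite subKn ?(ltnW kn)//.
  by have -> : (n - k).+1 = (n - k.-1)%N by case: k k0 kn h => // k _ kn h /=; rewrite subnSK// ltnW.
have k1 : k = 1%N by nat_lia.
rewrite k1 subn1 eqxx subn0 zeta_first mul0r addr0.
by [].
Qed.

Lemma tsig_pred_gt0 n : (0 < n <= N)%N -> t n.-1 < T n.
Proof. by case: n => // n /andP[_ nN]; exact: mesh_lt_tsig. Qed.

Lemma akern0E n : (0 < n <= N)%N ->
  akern t al th n 0 = C * (T n - t n.-1) `^ (1 - al) / (1 - al) / tau n.
Proof.
move=> n0; rewrite /akern subn0 min_r; last exact/ltW/tsig_lt_mesh.
have aT := tsig_pred_gt0 n n0.
have -> : g n = (fun s => C * (T n - s) `^ (- al)).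
  apply/funext => s; rewrite /varpi /omegaF -/C mulrC.
  by have -> : 1 - al - 1 = - al by ring.
rewrite /Rintegral; under eq_integral do rewrite EFinM.
rewrite ge0_integralZl_EFin//=.
- by rewrite integral_powR_sub// -EFinM/=; ring.
- by move=> s _; rewrite lee_fin powR_ge0.
- by apply/measurable_EFinP/measurable_funTS; exact: measurable_powR_sub.
Qed.

(** The interval of integration has length (1 - th) tau_n, so the mean of the singular kernel is a
    fixed multiple of its value at the left end. *)
Lemma akern0_varpi n : (0 < n <= N)%N ->
  (1 - al) * akern t al th n 0 = (1 - th) * g n (t n.-1).
Proof.
move=> n0; rewrite (akern0E n n0).
have aT := tsig_pred_gt0 n n0.
have tau0 := mtau_gt0 n n0.
have -> : g n (t n.-1) = C * (T n - t n.-1) `^ (- al).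
  rewrite /varpi /omegaF -/C mulrC.
  by have -> : 1 - al - 1 = - al by ring.
have p0 : 0 < T n - t n.-1 by rewrite subr_gt0.
have -> : (T n - t n.-1) `^ (1 - al) = (T n - t n.-1) * (T n - t n.-1) `^ (- al).
  by rewrite powRD ?powRr1 ?(ltW p0)//; apply/implyP => _; rewrite gt_eqF.
rewrite {1}tsig_sub; field.
by rewrite gt_eqF//= subr_eq0 gt_eqF.
Qed.

(** The factor 2 (1 - al) / (2 - al) turns a_0 into the kernel value at t_{n-1}, an endpoint of the
    preceding interval, so the tangent comparison extends to the diagonal. *)
Lemma ahat_diag n : (0 < n <= N)%N ->
  ahat t al th n 0 = g n (t n.-1) + zeta t al th n 1 / (mratio t n * (1 + mratio t n)).
Proof.
move=> n0; have h := akern0_varpi n n0.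
have th2 : 1 - th != 0 by rewrite gt_eqF.
have c : 2 * (1 - al) / (2 - al) * akern t al th n 0 = g n (t n.-1).
  apply: (mulfI th2); rewrite -h; field.
  by rewrite subr_eq0 gt_eqF//; have := al1; have := al0; lra.
rewrite /ahat; have -> : (n == 0%N) = false by nat_lia.
have [n1|n1] := eqVneq n 1%N; last by rewrite /= c.
by move: n0 c; rewrite n1 zeta_first mul0r addr0.
Qed.

(** The surplus comes from 1 = 2 (1 - al) / (2 - al) + al / (2 - al); it supplies the dissipation
    and absorbs the nonconvex part of the potential. *)
Lemma akern0_diag n : (0 < n <= N)%N ->
  akern t al th n 0 = ahat t al th n 0 - zeta t al th n 1 / (mratio t n * (1 + mratio t n))
     + al / (2 - al) * akern t al th n 0.
Proof.
move=> n0; rewrite (ahat_diag n n0) addrK.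
have h := akern0_varpi n n0.
have th2 : 1 - th != 0 by rewrite gt_eqF.
apply: (mulfI th2); rewrite mulrDr -h; field.
by rewrite subr_eq0 gt_eqF//; have := al1; have := al0; lra.
Qed.

Lemma varpi_continuous n x y : y < T n -> {within `[x, y], continuous (g n)}.
Proof. by rewrite varpi_pker0; exact: pker_continuous. Qed.

(** * Monotonicity along the columns of X m - k X n *)

Section Combination.
Variables (k : R) (m n : nat).
Hypotheses (k01 : 0 <= k <= 1) (m0 : (0 < m)%N) (mn : (m <= n)%N) (nN : (n <= N)%N).
Notation G := (pker R C k (T m) (T n) al).

Let TT' : T m <= T n. Proof. exact: tsig_le. Qed.

Lemma mean_varpi_sub x y : y < T m ->
  mean R (g m) x y - k * mean R (g n) x y = mean R G x y.
Proof.
move=> ym; rewrite -varpi_pker mean_linear//; apply: varpi_continuous => //.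
exact: lt_le_trans TT'.
Qed.

Lemma tilt_varpi_sub x y : y < T m ->
  tilt R (g m) x y - k * tilt R (g n) x y = tilt R G x y.
Proof.
move=> ym; rewrite -varpi_pker tilt_linear//; apply: varpi_continuous => //.
exact: lt_le_trans TT'.
Qed.

Lemma tilt_pred_le j : (0 < j)%N -> (j < m)%N ->
  tilt R G (t j.-1.-1) (t j.-1) / (mratio t j * (1 + mratio t j)) <=
  dpker R C k (T m) (T n) al (t j.-1) * (t j - t j.-1) / 6 * (3 + 2 * S).
Proof.
move=> j0 jm.
have jN : (j <= N)%N by nat_lia.
have jT : t j.-1 < T m by apply: mesh_lt_tsig; nat_lia.
have D0 : 0 <= dpker R C k (T m) (T n) al (t j.-1) by apply: dpker_ge0 => //; exact: ltW.
have tj : t j.-1 < t j by apply: mesh_pred_lt; nat_lia.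
have [j1|j1] := eqVneq j 1%N.
  have -> : tilt R G (t j.-1.-1) (t j.-1) = 0.
    by rewrite j1 /= tilt_diag.
  rewrite mul0r; apply: mulr_ge0; last by move/andP: S01 => [h _]; lra.
  by rewrite divr_ge0// mulr_ge0// subr_ge0 ltW.
have tj' : t j.-1.-1 < t j.-1 by apply: mesh_pred_lt; nat_lia.
have := tilt_previous_le R C k (T m) (T n) al C0 k01 TT' (ltW al0) _ _ _ S tj' tj jT.
apply; apply: (rstar_ratio R rs); last by apply: hr; nat_lia.
- by apply: lt_le_trans rs_ge; lra.
- exact: rsS.
Qed.

Lemma ahat_sub_interior j : (0 < j)%N -> (j < m)%N ->
  X m j - k * X n j = mean R G (t j.-1) (t j)
    + tilt R G (t j.-1.-1) (t j.-1) / (mratio t j * (1 + mratio t j))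
    - tilt R G (t j.-1) (t j) / (1 + mratio t j.+1).
Proof.
move=> j0 jm.
have jT : t j < T m by apply: mesh_lt_tsig; nat_lia.
have jT' : t j.-1 < T m by apply: mesh_lt_tsig; nat_lia.
rewrite !ahat_interior ?akern_mean ?zeta_tilt; try nat_lia.
have h1 := mean_varpi_sub (t j.-1) (t j) jT.
have h2 := tilt_varpi_sub (t j.-1) (t j) jT.
have h3 := tilt_varpi_sub (t j.-1.-1) (t j.-1) jT'.
rewrite -h1 -h2 -h3.
have E (a1 a2 b1 b2 c1 c2 d e : R) : a1 + b1 / d - c1 / e - k * (a2 + b2 / d - c2 / e) =
  a1 - k * a2 + (b1 - k * b2) / d - (c1 - k * c2) / e by ring.
exact: E.
Qed.

Lemma ahat_step_interior j : (0 < j)%N -> (j.+1 < m)%N ->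
  X m j - k * X n j <= X m j.+1 - k * X n j.+1.
Proof.
move=> j0 jm; rewrite -subr_ge0 !ahat_sub_interior; try nat_lia.
have jT : t j.+1 < T m by apply: mesh_lt_tsig; nat_lia.
have y3 : 1 / 3 <= mratio t j.+1 by apply: mratio_ge_third; nat_lia.
have z3 : 1 / 3 <= mratio t j.+2 by apply: mratio_ge_third; nat_lia.
have y0 : 0 < mratio t j.+1 by apply: lt_le_trans y3; lra.
have z0 : 0 < 1 + mratio t j.+2 by lra.
have ab : t j.-1 < t j by apply: mesh_pred_lt; nat_lia.
have bc : t j < t j.+1 by apply: tinc; nat_lia.
have yE : t j.+1 - t j = mratio t j.+1 * (t j - t j.-1).
  by rewrite -/(mtau t j) -mtauS; try nat_lia.
have l01 : 0 <= (1 + mratio t j.+2)^-1 <= 1.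
  by rewrite invr_ge0 ltW//= invf_le1//; lra.
have jm' : (j < m)%N by nat_lia.
have := kernel_step_ge0 R C k (T m) (T n) al C0 k01 TT' (ltW al0) _ _ _ _ S _ _
  ab bc jT y0 yE S01 l01 (tilt_pred_le j j0 jm').
rewrite /= => h; apply: le_trans h _; rewrite le_eqVlt; apply/orP; left; apply/eqP.
have E (a1 a2 b1 b2 b3 y z v : R) : 0 < y -> 0 < z ->
  a2 - z^-1 * b2 - a1 + b1 / y - b3 / v =
  a2 + b1 / (y * (1 + y)) - b2 / z - (a1 + b3 / v - b1 / (1 + y)).
  (* The tilt on [t_{j-1}, t_j] enters both columns; the two shares add up to b1 / y. *)
  move=> yp zp; have -> : b1 / y = b1 / (y * (1 + y)) + b1 / (1 + y).
    by field; rewrite !gt_eqF//; lra.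
  by ring.
exact: E.
Qed.

Lemma ahat_first_ge : (1 < m)%N -> 0 <= X m 1 - k * X n 1.
Proof.
move=> m1; rewrite ahat_sub_interior//.
have jT : t 1%N < T m by apply: mesh_lt_tsig; nat_lia.
have z3 : 1 / 3 <= mratio t 2 by apply: mratio_ge_third; nat_lia.
have z0 : 0 < 1 + mratio t 2 by lra.
have l01 : 0 <= (1 + mratio t 2)^-1 <= 1.
  by rewrite invr_ge0 ltW//= invf_le1//; lra.
have -> : tilt R G (t 1%N.-1.-1) (t 1%N.-1) = 0.
  exact: tilt_diag.
have ab : t 0%N < t 1%N by apply: tinc; nat_lia.
have := mean_sub_tilt_ge0 R C k (T m) (T n) al C0 k01 TT' (ltW al0) _ _ _ ab jT l01.
by rewrite mul0r addr0 (mulrC _ (tilt _ _ _ _)).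
Qed.

End Combination.

Lemma varpi_powR n s : g n s = C * (T n - s) `^ (- al).
Proof. by rewrite varpi_pker0 /pker /powdiff mul0r subr0. Qed.

Lemma varpi_ge0 n s : 0 <= g n s.
Proof. by rewrite varpi_powR mulr_ge0// powR_ge0. Qed.

Lemma akern0_ge0 n : (0 < n <= N)%N -> 0 <= akern t al th n 0.
Proof.
move=> n0; have h := akern0_varpi n n0; have v0 := varpi_ge0 n (t n.-1).
have p0 : 0 < 1 - al by rewrite subr_gt0.
rewrite -(pmulr_rge0 _ p0) h mulr_ge0//; have := al1; have := al0; lra.
Qed.

(** Trades a slope for a kernel value: the subtracted power is dropped and the remaining one
    increases from [a] to [b]. At b = t_{m-1} the factor T m - b is (1 - th) tau_m. *)
Lemma dpker_le k m n a b : 0 <= k -> a <= b -> b < T m ->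
  dpker R C k (T m) (T n) al a * (T m - b) <= al * g m b.
Proof.
move=> k0 ab bT; rewrite varpi_powR.
have Tb : 0 < T m - b by rewrite subr_gt0.
have -> : (T m - b) `^ (- al) = (T m - b) `^ (- (al + 1)) * (T m - b).
  rewrite -{3}(powRr1 (ltW Tb)) -powRD; last by apply/implyP => _; rewrite gt_eqF.
  by congr (_ `^ _); ring.
rewrite !mulrA ler_pM2r// /dpker (mulrA C) (mulrC al C) ler_wpM2l//.
  by apply: mulr_ge0 => //; exact: ltW.
apply: (@le_trans _ _ ((T m - a) `^ (- (al + 1)))).
  by rewrite /powdiff gerBl mulr_ge0// powR_ge0.
have -> : T m - a = (T m + (b - a)) - b by ring.
by apply: powR_sub_antitone => //; have := al0; lra.
Qed.

Lemma last_kernel_le m : (0 < m)%N -> (m < N)%N ->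
  mean R (g m.+1) (t m.-1) (t m) - tilt R (g m.+1) (t m.-1) (t m) / (1 + mratio t m.+1)
  <= g m (t m.-1) + (g m.+1 (t m.-1)) * (al / (1 + mratio t m.+1))
   - (g m (t m.-1) - g m.+1 (t m.-1)).
Proof.
move=> m0 mN.
have z3 : 1 / 3 <= mratio t m.+1 by apply: mratio_ge_third; nat_lia.
have z0 : 0 < mratio t m.+1 by apply: lt_le_trans z3; lra.
have ab : t m.-1 < t m by apply: mesh_pred_lt; nat_lia.
have bT : t m < T m.+1 by apply: mesh_lt_tsig; nat_lia.
(* The distance from t_m to T_{m+1} is (1 - th) tau_{m+1}, more than half a step as th < 1/2. *)
have hz : mratio t m.+1 / 2 * (t m - t m.-1) <= T m.+1 - t m.
  have -> : T m.+1 - t m = (1 - th) * (mratio t m.+1 * (t m - t m.-1)).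
    by have := tsig_sub m.+1; rewrite mtauS.
  have p : 0 <= mratio t m.+1 * (t m - t m.-1) by rewrite mulr_ge0// ltW// subr_gt0.
  rewrite mulrAC mulrC; apply: ler_wpM2r => //; have := al1; lra.
have := last_moment_le R C (T m.+1) al _ _ _ C0 al01 ab bT z0 hz.
rewrite -varpi_pker0 div1r (mulrC _ (tilt _ _ _ _)) => h; apply: le_trans h _.
by rewrite le_eqVlt; apply/orP; left; apply/eqP; ring.
Qed.

Lemma varpi_antitone m n s : (0 < m)%N -> (m <= n)%N -> (n <= N)%N -> s < T m ->
  g n s <= g m s.
Proof.
move=> m0 mn nN sT; rewrite !varpi_powR ler_wpM2l//.
by apply: powR_sub_antitone => //; [exact: ltW|exact: tsig_le].
Qed.

(** By [last_kernel_le] the entry X 2 1 is at most g_2(t_0) (1 + al / (1 + r_2)), hence at most 2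
    g_2(t_0), and kernels decrease with the time level. *)
Lemma ahat_diag_first : (1 < N)%N -> 0 <= 2 * ahat t al th 1 0 - X 2 1.
Proof.
move=> N1.
have z3 : 1 / 3 <= mratio t 2 by apply: mratio_ge_third; nat_lia.
have z1 : 0 < 1 + mratio t 2 by lra.
have a0 : t 0%N < T 1%N by apply: mesh_lt_tsig; nat_lia.
have := last_kernel_le 1 isT N1; rewrite /= => h.
have g12 := varpi_antitone 1 2 (t 0%N) isT isT N1 a0.
have g0 := varpi_ge0 2 (t 0%N).
have l1 : al / (1 + mratio t 2) <= 1.
  by rewrite ler_pdivrMr// mul1r; have := al1; lra.
rewrite ahat_diag ?(ltnW N1)// ahat_interior// akern_mean// !zeta_tilt// !zeta_first.
rewrite /= tilt_diag !mul0r !addr0.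
have h2 : g 2 (t 0%N) * (al / (1 + mratio t 2)) <= g 2 (t 0%N) * 1 by apply: ler_wpM2l.
lra.
Qed.

Lemma tilt_varpi_ge0 n x y : x < y -> y < T n -> 0 <= tilt R (g n) x y.
Proof.
move=> xy yT; rewrite varpi_pker0; apply: tilt_pker_ge0 => //.
- by rewrite lexx ler01.
- exact: ltW.
Qed.

(** At the diagonal there is no next mean to pay the deficit of [kernel_brace_ge]. The doubling in
    A_0 provides an extra g_m(t_{m-1}), which pays both for it and for the excess in
    [last_kernel_le]. *)
Lemma ahat_step_diag m : (1 < m)%N -> (m < N)%N ->
  X m m.-1 - X m.+1 m.-1 <= 2 * ahat t al th m 0 - X m.+1 m.
Proof.
move=> m1 mN.
have m0 : (0 < m)%N by nat_lia.
have jm : (m.-1 < m)%N by nat_lia.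
have j0 : (0 < m.-1)%N by nat_lia.
have jN : (0 < m.-1 <= N)%N by nat_lia.
have k01 : 0 <= (1 : R) <= 1 by rewrite ler01 lexx.
have jS : m.-1.+1 = m by nat_lia.
have ab : t m.-1.-1 < t m.-1 by apply: mesh_pred_lt; nat_lia.
have bT : t m.-1 < T m by apply: mesh_lt_tsig; nat_lia.
have TT : T m <= T m.+1 by apply: tsig_le; nat_lia.
have y3 : 1 / 3 <= mratio t m by apply: mratio_ge_third; nat_lia.
have z3 : 1 / 3 <= mratio t m.+1 by apply: mratio_ge_third; nat_lia.
have y0 : 0 < mratio t m by apply: lt_le_trans y3; lra.
have z0 : 0 < mratio t m.+1 by apply: lt_le_trans z3; lra.
have hZ := tilt_pred_le 1 m m.+1 k01 m0 (leqnSn m) mN m.-1 j0 jm.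
have hb := kernel_brace_ge R C 1 (T m) (T m.+1) al C0 k01 TT (ltW al0) _ _ _ S _ ab bT y0 hZ.
have hl := last_kernel_le m m0 mN.
have hD := dpker_le 1 m m.+1 _ _ ler01 (ltW ab) bT.
have hm : mratio t m * (t m.-1 - t m.-1.-1) = tau m.
  by have := mtauS m.-1 j0; rewrite jS => ->; last nat_lia.
have g12 := varpi_antitone m m.+1 (t m.-1) m0 (leqnSn m) mN bT.
have g0 := varpi_ge0 m (t m.-1).
have coef := boundary_coef R al S _ al01 hS z3.
have zt := tilt_varpi_ge0 m _ _ ab bT.
have := ahat_sub_interior 1 m m.+1 m0 (leqnSn m) mN m.-1 j0 jm.
rewrite mul1r => ->.
rewrite (ahat_diag m); last by rewrite m0 ltnW.
rewrite (ahat_interior m.+1 m); try nat_lia.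
rewrite (akern_mean m.+1 m); try nat_lia.
have -> : zeta t al th m 1 = tilt R (g m) (t m.-1.-1) (t m.-1).
  by rewrite -zeta_tilt ?leq_pred//; congr zeta; nat_lia.
rewrite !zeta_tilt; try nat_lia.
rewrite jS.
have hG : pker R C 1 (T m) (T m.+1) al (t m.-1) = g m (t m.-1) - g m.+1 (t m.-1).
  by rewrite -varpi_pker mul1r.
rewrite hG hm in hb.
rewrite tsig_sub in hD.
have ht := tilt_varpi_sub 1 m m.+1 m0 (leqnSn m) mN (t m.-1.-1) (t m.-1) bT.
rewrite mul1r in ht.
have z10 : 0 < 1 + mratio t m.+1 := addr_gt0 ltr01 z0.
move: hb hl hD ht zt coef g12 g0.
set D := dpker _ _ _ _ _ _ _; set tm := tau m; set gm := g m (t m.-1).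
set gn := g m.+1 (t m.-1); set y := mratio t m; set z := mratio t m.+1.
set tG := tilt R (pker _ _ _ _ _ _) (t m.-1.-1) (t m.-1); set Z := tilt _ _ _ _ / (mratio t m.-1 * _).
set mG := mean R (pker _ _ _ _ _ _) _ _; set mn := mean _ _ _ _; set tn := tilt R (g m.+1) (t m.-1) _.
set zm := tilt R (g m) _ _; set zn := tilt R (g m.+1) _ _.
move=> hb hl hD ht zt coef g12 g0; rewrite -ht in hb *.
exact: (boundary_balance R S al y z D tm gm gn mG Z mn tn zm zn al01 y0 z10 hb hl hD zt coef g12 g0).
Qed.

(** The same comparison with one kernel, k = 0. The right side is the full coefficient of the newest
    increment, so this gap is what drives the bound on the solution. *)
Lemma ahat_diag_gap n : 2 / 5 <= al -> (1 < n)%N -> (n <= N)%N ->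
  X n n.-1 + th * akern t al th n 0 <=
  akern t al th n 0 + zeta t al th n 1 / (mratio t n * (1 + mratio t n)).
Proof.
move=> al25 n1 nN.
have n0 : (0 < n)%N by nat_lia.
have n0N : (0 < n <= N)%N by nat_lia.
have jm : (n.-1 < n)%N by nat_lia.
have j0 : (0 < n.-1)%N by nat_lia.
have k01 : 0 <= (0 : R) <= 1 by rewrite lexx ler01.
have jS : n.-1.+1 = n by nat_lia.
have ab : t n.-1.-1 < t n.-1 by apply: mesh_pred_lt; nat_lia.
have bT : t n.-1 < T n by apply: mesh_lt_tsig; nat_lia.
have y3 : 1 / 3 <= mratio t n by apply: mratio_ge_third; nat_lia.
have y0 : 0 < mratio t n by apply: lt_le_trans y3; lra.
have hZ := tilt_pred_le 0 n n k01 n0 (leqnn n) nN n.-1 j0 jm.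
have hb := kernel_brace_ge R C 0 (T n) (T n) al C0 k01 (lexx _) (ltW al0) _ _ _ S _ ab bT y0 hZ.
have hD := dpker_le 0 n n _ _ (lexx 0) (ltW ab) bT.
have hm : mratio t n * (t n.-1 - t n.-1.-1) = tau n.
  by have := mtauS n.-1 j0; rewrite jS => ->; last nat_lia.
have g0 := varpi_ge0 n (t n.-1).
have al2 : 2 / 5 <= al < 1 by rewrite al25 al1.
have coef := first_kernel_coef R al S al2 hS.
have ha := akern0_varpi n n0N.
have := ahat_sub_interior 0 n n n0 (leqnn n) nN n.-1 j0 jm.
rewrite mul0r subr0 => ->.
have -> : zeta t al th n 1 = tilt R (g n) (t n.-1.-1) (t n.-1).
  by rewrite -zeta_tilt ?leq_pred//; congr zeta; nat_lia.
rewrite varpi_pker0 in ha g0 *.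
rewrite jS; rewrite hm in hb; rewrite tsig_sub varpi_pker0 in hD.
exact: (first_balance R S al _ _ _ _ _ _ _ _ al2 y0 hb hD ha coef g0).
Qed.

(* The step restriction bounds [akern n 0] from below because
   [(1 - al) * GammaF (1 - al) <= GammaF (2 - al)] *)
Lemma akern0_step_ge n B : (0 < n <= N)%N -> 0 < B ->
  tau n <= (B * omegaF (2 - al) (1 - th)) `^ (1 / al) ->
  1 <= B * akern t al th n 0.
Proof.
move=> n0 B0 hstep; rewrite akern0E// tsig_sub.
have tau0 := mtau_gt0 n n0.
have th0 := th1.
have p0 : 0 < 1 - al by rewrite subr_gt0.
have r01 : 0 < 1 - al < 1 by rewrite p0 gtrBl al0.
have := Gamma_succ_ge R (1 - al) r01.
have -> : 1 - al + 1 = 2 - al by ring.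
move=> /andP[G0 G1]; have G2 : 0 < GammaF (2 - al) := lt_le_trans G0 G1.
have Gp := Gamma_onem_gt0.
have om0 : 0 <= B * omegaF (2 - al) (1 - th).
  by rewrite mulr_ge0 ?(ltW B0)// divr_ge0 ?powR_ge0// ltW.
have h1 : tau n `^ al <= B * omegaF (2 - al) (1 - th).
  have := ge0_ler_powR (ltW al0) (_ : tau n \in Num.nneg) (_ : _ \in Num.nneg) hstep.
  rewrite !nnegrE powR_ge0 (ltW tau0) => /(_ isT isT).
  by rewrite -powRrM mul1r mulVf ?gt_eqF// powRr1.
have -> : ((1 - th) * tau n) `^ (1 - al) = (1 - th) `^ (1 - al) * (tau n / tau n `^ al).
  rewrite (powRM _ (ltW th0) (ltW tau0)); congr (_ * _).
  by rewrite powRB ?powRr1 ?(ltW tau0)//; apply/implyP => _; rewrite gt_eqF.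
have ta0 : 0 < tau n `^ al by rewrite powR_gt0.
have -> : B * (C * ((1 - th) `^ (1 - al) * (tau n / tau n `^ al)) / (1 - al) / tau n) =
   B * (1 - th) `^ (1 - al) * (C / (1 - al)) / tau n `^ al.
  by field; rewrite !gt_eqF.
rewrite ler_pdivlMr// mul1r; apply: le_trans h1 _.
rewrite /omegaF mulrA; have -> : 2 - al - 1 = 1 - al by ring.
apply: ler_wpM2l; first by rewrite mulr_ge0 ?powR_ge0// ltW.
rewrite /C -invfM lef_pV2 ?posrE ?mulr_gt0//.
by rewrite mulrC.
Qed.

End MeshKernels.

(** * A quadratic form in tail sums and its increment *)

Section QuadraticForm.
Variable R : realType.
Implicit Types (b w : nat -> R) (n : nat).

Definition tailsum w j n : R := \sum_(j.+1 <= l < n.+1) w l.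

Definition quadform b w n : R :=
  \sum_(1 <= j < n) (b j.+1 - b j) * tailsum w j n ^+ 2 + b 1%N * tailsum w 0 n ^+ 2.

Lemma tailsumS w j n : (j <= n)%N -> tailsum w j n.+1 = tailsum w j n + w n.+1.
Proof. by move=> jn; rewrite /tailsum big_nat_recr. Qed.

Lemma tailsum_diag w n : tailsum w n n = 0.
Proof. by rewrite /tailsum big_geq. Qed.

Lemma quadform0 b w : quadform b w 0 = 0.
Proof. by rewrite /quadform big_geq// tailsum_diag expr0n/= mulr0 addr0. Qed.

Lemma summation_by_parts b w n :
  \sum_(1 <= j < n.+1) (b j.+1 - b j) * tailsum w j n + b 1%N * tailsum w 0 n =
  \sum_(1 <= k < n.+1) b k * w k.
Proof.
elim: n => [|n IH].
  by rewrite !big_geq// tailsum_diag mulr0 addr0.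
rewrite [RHS]big_nat_recr//= -IH [in LHS]big_nat_recr//= tailsum_diag mulr0 addr0.
rewrite (tailsumS _ 0)//.
have -> : \sum_(1 <= j < n.+1) (b j.+1 - b j) * tailsum w j n.+1 =
  \sum_(1 <= j < n.+1) (b j.+1 - b j) * tailsum w j n + (b n.+1 - b 1%N) * w n.+1.
  rewrite -(telescope_sumr b (ltn0Sn n)) mulr_suml -big_split/=.
  by apply: eq_big_nat => j /andP[_ jn]; rewrite tailsumS// mulrDr.
ring.
Qed.

(** Every tail sum gains w_{n+1}. The cross terms are summed by parts, and the squares telescope.
    The last term is why the diagonal entry is doubled: with b_{n+1} twice the diagonal coefficient,
    the right side becomes 2 w_{n+1} times the undoubled convolution. *)
Lemma quadformS b w n : quadform b w n.+1 - quadform b w n =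
  2 * w n.+1 * (\sum_(1 <= k < n.+2) b k * w k) - b n.+1 * w n.+1 ^+ 2.
Proof.
rewrite [in RHS]big_nat_recr//= -summation_by_parts /quadform (tailsumS _ 0)//.
have -> : \sum_(1 <= j < n.+1) (b j.+1 - b j) * tailsum w j n.+1 ^+ 2 =
  \sum_(1 <= j < n.+1) (b j.+1 - b j) * tailsum w j n ^+ 2 +
  2 * w n.+1 * (\sum_(1 <= j < n.+1) (b j.+1 - b j) * tailsum w j n) +
  w n.+1 ^+ 2 * (b n.+1 - b 1%N).
  rewrite -(telescope_sumr b (ltn0Sn n)) !mulr_sumr -!big_split/=.
  by apply: eq_big_nat => j /andP[_ jn]; rewrite tailsumS//; ring.
have -> : \sum_(1 <= j < n.+1) (b j.+1 - b j) * tailsum w j n ^+ 2 =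
  \sum_(1 <= j < n) (b j.+1 - b j) * tailsum w j n ^+ 2.
  case: n => [|n]; first by rewrite !big_geq.
  by rewrite big_nat_recr//= tailsum_diag expr0n/= mulr0 addr0.
ring.
Qed.

Lemma quadform_le b b' w n : 0 <= b' 1%N - b 1%N ->
  (forall j, (0 < j < n)%N -> b' j - b j <= b' j.+1 - b j.+1) ->
  quadform b w n <= quadform b' w n.
Proof.
move=> h1 h; rewrite /quadform; apply: lerD; last first.
  by apply: ler_wpM2r; [exact: sqr_ge0|rewrite -subr_ge0].
apply: ler_sum_nat => j jn; apply: ler_wpM2r; first exact: sqr_ge0.
by have := h j jn; lra.
Qed.

End QuadraticForm.

(** * Discrete gradient structure of the convolution *)

Section GradientStructure.
Variables (R : realType) (al rs S : R) (N : nat) (t : nat -> R).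
Hypotheses (al01 : 0 < al < 1)
  (tinc : forall k, (k < N)%N -> t k < t k.+1).
Hypotheses (rs_ge : 1 / 3 <= rs) (S01 : 0 <= S <= 1)
  (rsS : 1 / (rs ^+ 2 * (1 + rs)) = 3 + 2 * S)
  (hr : forall k, (2 <= k <= N)%N -> rs <= mratio t k)
  (hS : S ^+ 2 <= 2 / 3 * (1 - al / 2) / (1 + al / 2) + 1 / 3).
Notation th := (al / 2).

Let Ab n k : R := Akern t al th n (n - k).

Lemma Gfun_quadform n w : Gfun t al th n w = quadform R (Ab n) w n.
Proof.
rewrite /Gfun; case: n => [|n]; first by rewrite quadform0.
by rewrite /quadform /tailsum /Ab /= subn1; congr (_ + _); apply: eq_big_nat => j _; rewrite -subnDA addn1.
Qed.

Lemma Akern_step m : (0 < m)%N -> (m < N)%N ->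
  0 <= Ab m 1 - Ab m.+1 1 /\
  forall j, (0 < j < m)%N -> Ab m j - Ab m.+1 j <= Ab m j.+1 - Ab m.+1 j.+1.
Proof.
move=> m0 mN.
have k01 : 0 <= (1 : R) <= 1 by rewrite ler01 lexx.
have AbE n k : (k < n)%N -> Ab n k = ahat t al th n (n - k).
  by rewrite /Ab /Akern -subn_gt0 lt0n => /negbTE ->.
have AbD n : Ab n n = 2 * ahat t al th n 0 by rewrite /Ab subnn.
split=> [|j /andP[j0 jm]].
  move: (m0); rewrite leq_eqVlt => /orP[/eqP m1|m1].
    have N1 : (1 < N)%N by rewrite m1.
    by rewrite -m1 AbD AbE//; exact: (ahat_diag_first R al rs N t al01 tinc rs_ge hr N1).
  rewrite !AbE; try nat_lia.
  have := ahat_first_ge R al rs N t al01 tinc rs_ge hr 1 m m.+1 k01 m0 (leqnSn m) mN m1.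
  by rewrite mul1r.
move: (jm); rewrite leq_eqVlt => /orP[/eqP jE|jm1].
  have m1 : (1 < m)%N by rewrite -jE ltnS.
  have h := ahat_step_diag R al rs S N t al01 tinc rs_ge S01 rsS hr hS m m1 mN.
  move: h jm mN; rewrite -jE /= => h jm mN.
  by rewrite AbD !AbE; try nat_lia.
rewrite !AbE; try nat_lia.
have := ahat_step_interior R al rs S N t al01 tinc rs_ge S01 rsS hr 1 m m.+1 k01 m0
  (leqnSn m) mN j j0 jm1.
by rewrite !mul1r.
Qed.

(** The convolution is exactly the increment of the form with the kernels of level n kept fixed.
    Replacing them by those of level n - 1 in the subtracted form costs nothing, by [Akern_step]. *)
Lemma sum_ahat_ge n (w : nat -> R) : (0 < n <= N)%N ->
  Gfun t al th n w - Gfun t al th n.-1 w <=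
  2 * w n * \sum_(1 <= k < n.+1) ahat t al th n (n - k) * w k.
Proof.
case: n => // m /= mN.
have -> : 2 * w m.+1 * \sum_(1 <= k < m.+2) ahat t al th m.+1 (m.+1 - k) * w k =
  quadform R (Ab m.+1) w m.+1 - quadform R (Ab m.+1) w m.
  rewrite quadformS !(big_nat_recr m.+1)//= {2 3}/Ab subnn /Akern /=.
  have -> : \sum_(1 <= k < m.+1) Ab m.+1 k * w k =
      \sum_(1 <= k < m.+1) ahat t al th m.+1 (m.+1 - k) * w k.
    apply: eq_big_nat => k /andP[_ km].
    by rewrite /Ab /Akern -{1}[0%N]/(0%N) subn_eq0 leqNgt km.
  ring.
rewrite !Gfun_quadform lerD2l lerN2.
(* At the first level the subtracted form is zero, in agreement with G_0 = 0. *)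
case: m mN => [|m] mN.
  have Q0 b : quadform R b w 0 <= 0 by rewrite quadform0.
  have Q0' b : 0 <= quadform R b w 0 by rewrite quadform0.
  exact: le_trans (Q0 _) (Q0' _).
have [h1 h2] := Akern_step m.+1 isT mN.
exact: quadform_le.
Qed.

Lemma L2sigma_ahat n (v : nat -> R) : (0 < n <= N)%N ->
  L2sigma t al th n v =
  al / (2 - al) * akern t al th n 0 * (v n - v n.-1) +
  \sum_(1 <= k < n.+1) ahat t al th n (n - k) * (v k - v k.-1).
Proof.
move=> n0; have /andP[np nN] := n0; rewrite /L2sigma.
pose w k := v k - v k.-1.
pose e k : R := zeta t al th n (n - k) / (mratio t k.+1 * (1 + mratio t k.+1)).
pose u k : R := akern t al th n (n - k) - zeta t al th n (n - k) / (1 + mratio t k.+1).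
have hn : \sum_(1 <= k < n) (akern t al th n (n - k) * w k +
    (w k.+1 - mratio t k.+1 * w k) / (mratio t k.+1 * (1 + mratio t k.+1)) *
      zeta t al th n (n - k)) =
   \sum_(1 <= k < n) u k * w k + \sum_(1 <= k < n) e k * w k.+1.
  rewrite -big_split/=; apply: eq_big_nat => k /andP[k0 kn].
  have r3 : 1 / 3 <= mratio t k.+1.
    by apply: (mratio_ge_third R rs N t) => //; rewrite ltnS k0 (leq_trans kn).
  have r0 : 0 < mratio t k.+1 by apply: lt_le_trans r3; lra.
  rewrite /u /e; field.
  by rewrite !gt_eqF// addr_gt0.
have hX : \sum_(1 <= k < n) ahat t al th n (n - k) * w k =
   \sum_(1 <= k < n) u k * w k + \sum_(1 <= k < n) e k.-1 * w k.
  rewrite -big_split/=; apply: eq_big_nat => k kn.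
  rewrite (ahat_interior R al N t)// /u /e.
  have -> : k.-1.+1 = k by case/andP: kn => [k0 _]; rewrite prednK.
  have E (a b c x : R) : (a + b - c) * x = (a - c) * x + b * x by ring.
  exact: E.
(* The part of each summand attached to the next increment is shifted by one index. The mismatch
   telescopes to a single term at n, as [e 0] vanishes by [zeta_first]. *)
have tele : \sum_(1 <= k < n) e k * w k.+1 - \sum_(1 <= k < n) e k.-1 * w k = e n.-1 * w n.
  rewrite -sumrB (telescope_sumr (fun k => e k.-1 * w k) np) /=.
  by rewrite /e subn0 (zeta_first R al t n) !mul0r subr0.
have hd := akern0_diag R al N t al01 tinc n n0.
have en : e n.-1 = zeta t al th n 1 / (mratio t n * (1 + mratio t n)).
  rewrite /e prednK//; congr (zeta t al th n _ / _).
  by rewrite -subn1 subKn.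
rewrite -/(w n) big_nat_recr//= subnn -/(w n).
transitivity (akern t al th n 0 * w n + (\sum_(1 <= k < n) u k * w k + \sum_(1 <= k < n) e k * w k.+1)).
  by rewrite -hn.
transitivity (al / (2 - al) * akern t al th n 0 * w n +
  (\sum_(1 <= k < n) ahat t al th n (n - k) * w k + ahat t al th n 0 * w n)); last by [].
rewrite hX; rewrite -en in hd.
rewrite {1}hd -[\sum_(1 <= k < n) e k * w k.+1](subrK (\sum_(1 <= k < n) e k.-1 * w k)) tele.
have E (a x d s1 s2 y : R) : (a - d + x) * y + (s1 + (d * y + s2)) = x * y + (s1 + s2 + a * y).
  by ring.
exact: E.
Qed.
End GradientStructure.

(** * Summation by parts and maximum points on the periodic grid *)

Section PeriodicGrid.
Variables (R : realType) (M : nat) (h : R).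
Implicit Types u v w : grid R M.

Lemma sum_ordS (f : 'I_M -> R) : \sum_i f (ordS i) = \sum_i f i.
Proof. by rewrite [RHS](reindex_inj (can_inj (@ordSK M))). Qed.

Lemma sum_second_difference (u w : 'I_M -> R) :
  \sum_i (u (ordS i) + u (ord_pred i) - 2 * u i) * w i =
  - \sum_i (u (ordS i) - u i) * (w (ordS i) - w i).
Proof.
have e1 : \sum_i u (ord_pred i) * w i = \sum_i u i * w (ordS i).
  rewrite -(sum_ordS (fun i => u (ord_pred i) * w i)).
  by apply: eq_bigr => i _; rewrite ordSK.
have e2 := sum_ordS (fun i => u i * w i).
have -> : \sum_i (u (ordS i) + u (ord_pred i) - 2 * u i) * w i =
  \sum_i u (ordS i) * w i + \sum_i u (ord_pred i) * w i - \sum_i u i * w i - \sum_i u i * w i.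
  rewrite -big_split/= -!sumrB.
  by apply: eq_bigr => i _; ring.
rewrite e1 -{1}e2 -big_split/= -!sumrB -sumrN.
by apply: eq_bigr => i _; ring.
Qed.

Lemma sum_lap_mul u w : \sum_i \sum_j lap h u i j * w i j =
  - \sum_i \sum_j ((u (ordS i) j - u i j) / h * ((w (ordS i) j - w i j) / h) +
                   (u i (ordS j) - u i j) / h * ((w i (ordS j) - w i j) / h)).
Proof.
have -> : \sum_i \sum_j lap h u i j * w i j =
  (h ^- 2) * ((\sum_i \sum_j (u (ordS i) j + u (ord_pred i) j - 2 * u i j) * w i j) +
  \sum_i \sum_j (u i (ordS j) + u i (ord_pred j) - 2 * u i j) * w i j).
  rewrite -big_split/= mulr_sumr; apply: eq_bigr => i _.
  rewrite -big_split/= mulr_sumr; apply: eq_bigr => j _.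
  by rewrite /lap; ring.
have -> : \sum_i \sum_j (u (ordS i) j + u (ord_pred i) j - 2 * u i j) * w i j =
  - \sum_i \sum_j (u (ordS i) j - u i j) * (w (ordS i) j - w i j).
  rewrite exchange_big/= [in RHS]exchange_big/= -sumrN; apply: eq_bigr => j _.
  exact: (sum_second_difference (fun i => u i j) (fun i => w i j)).
have -> : \sum_i \sum_j (u i (ordS j) + u i (ord_pred j) - 2 * u i j) * w i j =
  - \sum_i \sum_j (u i (ordS j) - u i j) * (w i (ordS j) - w i j).
  rewrite -sumrN; apply: eq_bigr => i _.
  exact: sum_second_difference.
rewrite -opprD mulrN; congr (- _).
rewrite -big_split/= mulr_sumr; apply: eq_bigr => i _.
rewrite -big_split/= mulr_sumr; apply: eq_bigr => j _.
by rewrite -exprVn; ring.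
Qed.

(** After summation by parts the claim holds for each difference quotient, with remainder (1/2 - th)
    (b - a)^2. *)
Lemma gradsq_theta_le (th : R) u v : th <= 1 / 2 ->
  h ^+ 2 * \sum_i \sum_j lap h (fun a b => th * u a b + (1 - th) * v a b) i j * (v i j - u i j)
  <= - (1 / 2) * (gradsq h v - gradsq h u).
Proof.
move=> th2; rewrite (sum_lap_mul _ (fun i j => v i j - u i j)) /gradsq -mulrBr.
rewrite mulrCA; apply: ler_wpM2l; first exact: sqr_ge0.
rewrite mulNr lerN2 -sumrB mulr_sumr; apply: ler_sum => i _.
rewrite -sumrB mulr_sumr; apply: ler_sum => j _.
have E (a b : R) : (1 / 2) * (b ^+ 2 - a ^+ 2) <= (th * a + (1 - th) * b) * (b - a).
  rewrite -subr_ge0.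
  have -> : (th * a + (1 - th) * b) * (b - a) - 1 / 2 * (b ^+ 2 - a ^+ 2) =
    (1 / 2 - th) * (b - a) ^+ 2 by field.
  by apply: mulr_ge0; [rewrite subr_ge0|exact: sqr_ge0].
have := lerD (E ((u (ordS i) j - u i j) / h) ((v (ordS i) j - v i j) / h))
  (E ((u i (ordS j) - u i j) / h) ((v i (ordS j) - v i j) / h)).
set a1 := (u (ordS i) j - u i j) / h; set b1 := (v (ordS i) j - v i j) / h.
set a2 := (u i (ordS j) - u i j) / h; set b2 := (v i (ordS j) - v i j) / h.
have -> : (th * u (ordS i) j + (1 - th) * v (ordS i) j - (th * u i j + (1 - th) * v i j)) / h
  = th * a1 + (1 - th) * b1 by rewrite /a1 /b1; ring.
have -> : (th * u i (ordS j) + (1 - th) * v i (ordS j) - (th * u i j + (1 - th) * v i j)) / h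
  = th * a2 + (1 - th) * b2 by rewrite /a2 /b2; ring.
have -> : (v (ordS i) j - u (ordS i) j - (v i j - u i j)) / h = b1 - a1 by rewrite /a1 /b1; ring.
have -> : (v i (ordS j) - u i (ordS j) - (v i j - u i j)) / h = b2 - a2 by rewrite /a2 /b2; ring.
apply: le_trans.
by rewrite le_eqVlt; apply/orP; left; apply/eqP; ring.
Qed.

Lemma ipZZ (c : R) u : ip h (fun i j => u i j / c) (fun i j => u i j / c) =
  ip h u u / c ^+ 2.
Proof.
rewrite /ip -mulrA mulr_suml; congr (_ * _); apply: eq_bigr => i _.
rewrite mulr_suml; apply: eq_bigr => j _.
by rewrite -exprVn; ring.
Qed.

Lemma lap_le_max u (K : R) i j : (forall a b, u a b <= K) ->
  lap h u i j <= 4 / h ^+ 2 * (K - u i j).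
Proof.
move=> uK; have -> : 4 / h ^+ 2 * (K - u i j) = (4 * (K - u i j)) / h ^+ 2 by ring.
apply: ler_wpM2r; first by rewrite invr_ge0 sqr_ge0.
have := uK (ordS i) j; have := uK (ord_pred i) j.
have := uK i (ordS j); have := uK i (ord_pred j); lra.
Qed.

Lemma lap_theta (th : R) u v i j :
  lap h (fun a b => th * u a b + (1 - th) * v a b) i j =
  th * lap h u i j + (1 - th) * lap h v i j.
Proof. by rewrite /lap; ring. Qed.

(** Oddness of the reaction; lower bounds on the solution thus follow from upper bounds. *)
Lemma scheme_stepN (t : nat -> R) (al th eps : R) (phi : nat -> grid R M) n :
  scheme_step h t al th eps phi n ->
  scheme_step h t al th eps (fun k i j => - phi k i j) n.
Proof.
move=> hs i j; have := hs i j; set X := L2sigma _ _ _ _ _ => hX.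
have -> : L2sigma t al th n (fun k => - phi k i j) = - X.
  rewrite /X /L2sigma opprD -sumrN; congr (_ + _); first by ring.
  apply: eq_bigr => k _; ring.
rewrite hX /lap /fAC; ring.
Qed.
End PeriodicGrid.

(** * Abel summation for monotone weights *)

Section DelayedSum.
Variable R : realType.

(** Summation by parts leaves b_1 u_0 and the terms (b_{k+1} - b_k) u_k, all nonnegative, besides
    the term kept on the left. *)
Lemma sum_decrement_ge (b u : nat -> R) m : (0 < m)%N -> 0 <= b 1%N ->
  (forall k, (0 < k < m)%N -> b k <= b k.+1) -> (forall k, (k < m)%N -> 0 <= u k) ->
  - (b m * u m) <= \sum_(1 <= k < m.+1) b k * (u k.-1 - u k).
Proof.
case: m => // m _ b1; elim: m => [|m IH] hb hu.
  rewrite big_nat1 /= mulrBr lerBrDr addNr.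
  by apply: mulr_ge0 => //; exact: hu.
rewrite big_nat_recr//=.
have h2 : - (b m.+1 * u m.+1) <= \sum_(1 <= k < m.+2) b k * (u k.-1 - u k).
  by apply: IH => k hk; [apply: hb|apply: hu]; lia.
have h3 : b m.+1 * u m.+1 <= b m.+2 * u m.+1.
  by apply: ler_wpM2r; [apply: hu|apply: hb]; lia.
lra.
Qed.
End DelayedSum.

(** * Boundedness of the solution and decay of the modified energy *)

Section Scheme.
Variables (R : realType) (al rs S eps h : R) (M N : nat) (t : nat -> R).
Hypotheses (al01 : 0 < al < 1)
  (tinc : forall k, (k < N)%N -> t k < t k.+1).
Hypotheses (rs_ge : 1 / 3 <= rs) (S01 : 0 <= S <= 1)
  (rsS : 1 / (rs ^+ 2 * (1 + rs)) = 3 + 2 * S)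
  (hr : forall k, (2 <= k <= N)%N -> rs <= mratio t k)
  (hS : S ^+ 2 <= 2 / 3 * (1 - al / 2) / (1 + al / 2) + 1 / 3).
Hypotheses (stepF : forall n, (0 < n <= N)%N ->
    1 <= al / 2 / (2 * (1 - al / 2)) * akern t al (al / 2) n 0)
  (stepD : forall n, (0 < n <= N)%N ->
    4 * eps ^+ 2 / h ^+ 2 <= akern t al (al / 2) n 0).
Notation th := (al / 2).

Let al0 : 0 < al. Proof. by case/andP: al01. Qed.
Let al1 : al < 1. Proof. by case/andP: al01. Qed.
Let th01 : 0 < th < 1 / 2.
Proof. by have := al0; have := al1 => a b; apply/andP; split; lra. Qed.

(** With u_k = K - v_k nonnegative in the past, the history sum is bounded by its last weight times
    u_{n-1}. The gap between that weight and [B] leaves th a_0 u_{n-1}. *)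
Lemma L2sigma_ge n K : 2 / 5 <= al -> (0 < n <= N)%N ->
  exists2 B, 0 <= B & forall v, (forall k, (k < n)%N -> v k <= K) ->
    th * akern t al th n 0 * (K - v n.-1) + B * (v n - K) <= L2sigma t al th n v.
Proof.
move=> al25 n0N; have /andP[n0 nN] := n0N.
set a0 := akern t al th n 0.
have a00 : 0 <= a0 := akern0_ge0 R al N t al01 tinc n n0N.
pose B := a0 + zeta t al th n 1 / (mratio t n * (1 + mratio t n)).
have BE : B = ahat t al th n 0 + al / (2 - al) * a0.
  rewrite /B {1}/a0 (akern0_diag R al N t al01 tinc n n0N) -/a0.
  by rewrite addrAC subrK.
pose b k := ahat t al th n (n - k).
have LE v : L2sigma t al th n v =
    B * (v n - v n.-1) + \sum_(1 <= k < n) b k * (v k - v k.-1).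
  rewrite (L2sigma_ahat R al rs N t al01 tinc rs_ge hr n v n0N).
  rewrite big_nat_recr//= subnn BE mulrDl -/a0.
  have E (x y z : R) : x + (y + z) = z + x + y by ring.
  exact: E.
have th1 : th * a0 <= a0 by rewrite ler_piMl//; have := al1; lra.
have [n1|n1] := eqVneq n 1%N.
  have B1 : B = a0 by rewrite /B n1 zeta_first mul0r addr0.
  exists B => [|v hv]; first by rewrite B1.
  rewrite LE n1 big_geq// addr0 /= B1.
  have h0 : v 0%N <= K by apply: hv; rewrite n1.
  have u0 : 0 <= K - v 0%N by rewrite subr_ge0.
  exact/delay_balance_first/(ler_wpM2r u0 th1).
have n2 : (1 < n)%N by nat_lia.
have gap := ahat_diag_gap R al rs S N t al01 tinc rs_ge S01 rsS hr hS n al25 n2 nN.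
have k01 : 0 <= (0 : R) <= 1 by rewrite ler01 lexx.
have b1 : 0 <= b 1%N.
  have := ahat_first_ge R al rs N t al01 tinc rs_ge hr 0 n n k01 n0 (leqnn n) nN n2.
  by rewrite mul0r subr0.
have bm k : (0 < k < n.-1)%N -> b k <= b k.+1.
  move=> /andP[kp kn].
  have kn' : (k.+1 < n)%N by nat_lia.
  have := ahat_step_interior R al rs S N t al01 tinc rs_ge S01 rsS hr 0 n n k01 n0
    (leqnn n) nN k kp kn'.
  by rewrite !mul0r !subr0.
have bpos k : (0 < k < n)%N -> 0 <= b k.
  elim: k => // k IH /andP[_ kn]; have [->//|kp] := eqVneq k 0%N.
  by apply: le_trans (bm k _); [apply: IH|]; nat_lia.
have bB : b n.-1 + th * a0 <= B by exact: gap.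
exists B => [|v hv].
  apply: le_trans bB; apply: addr_ge0; first by apply: bpos; nat_lia.
  by apply: mulr_ge0 => //; apply: divr_ge0 => //; exact: ltW.
have hs := sum_decrement_ge R b (fun k => K - v k) n.-1.
have {}hs : - (b n.-1 * (K - v n.-1)) <= \sum_(1 <= k < n) b k * (v k - v k.-1).
  have -> : \sum_(1 <= k < n) b k * (v k - v k.-1) =
     \sum_(1 <= k < n.-1.+1) b k * ((K - v k.-1) - (K - v k)).
    by rewrite prednK//; apply: eq_bigr => k _; congr (_ * _); ring.
  apply: hs => // [|k kn]; first by nat_lia.
  by rewrite subr_ge0; apply: hv; nat_lia.
rewrite LE.
have u0 : 0 <= K - v n.-1 by rewrite subr_ge0; apply: hv; nat_lia.
exact: (delay_balance R _ _ _ _ _ _ _ (ler_wpM2r u0 bB) hs).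
Qed.

(** Argument at a grid maximum with value y > 2: the implicit Laplacian is nonpositive there and the
    reaction exceeds its value at 2. The explicit diffusion is absorbed by th a_0 (2 - x) through
    [stepD], and [relaxed_bound_coef] gives the contradiction. *)
Lemma scheme_le n (phi : nat -> grid R M) : 2 / 5 <= al -> (0 < n <= N)%N ->
  (forall k i j, (k < n)%N -> `|phi k i j| <= 2) ->
  scheme_step h t al th eps phi n -> forall i j, phi n i j <= 2.
Proof.
move=> al25 n0N hk hs i j; have /andP[n0 nN] := n0N.
have [p _ hp] := @arg_maxP _ _ _ (i, j) predT (fun p => phi n p.1 p.2) isT.
have pmax a b : phi n a b <= phi n p.1 p.2 := hp (a, b) isT.
apply: le_trans (pmax i j) _; rewrite leNgt; apply/negP => p2.
have [B B0 hB] := L2sigma_ge n 2 al25 n0N.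
have := hB (fun k => phi k p.1 p.2) _.
have hk' k : (k < n)%N -> phi k p.1 p.2 <= 2 by move=> /(hk k p.1 p.2); apply: le_trans; exact: ler_norm.
move=> /(_ hk'); rewrite (hs p.1 p.2) lap_theta.
have np : (n.-1 < n)%N by rewrite prednK.
set x := phi n.-1 p.1 p.2; set y := phi n p.1 p.2.
have ly : lap h (phi n) p.1 p.2 <= 0.
  have := lap_le_max R M h (phi n) y p.1 p.2 (fun a b => pmax a b).
  by rewrite -/y subrr mulr0.
have lx : lap h (phi n.-1) p.1 p.2 <= 4 / h ^+ 2 * (2 - x).
  apply: lap_le_max => a b; apply: le_trans (hk _ a b np); exact: ler_norm.
have hx : `|x| <= 2 := hk _ _ _ np.
set a0 := akern t al th n 0.
have d0 : 0 <= th * (a0 - 4 * eps ^+ 2 / h ^+ 2).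
  apply: mulr_ge0; last by rewrite subr_ge0; exact: stepD.
  by apply: divr_ge0 => //; exact: ltW.
have key := relaxed_bound_coef R th _ x th01 d0 hx.
have fy : fAC 2 < fAC y.
  rewrite -subr_gt0; have -> : fAC y - fAC 2 = (y - 2) * (y ^+ 2 + 2 * y + 3) by rewrite /fAC; ring.
  by apply: mulr_gt0; [rewrite subr_gt0|nra].
have /andP[t1 t2] := th01.
have fy' : (1 - th) * fAC 2 < (1 - th) * fAC y by rewrite ltr_pM2l//; lra.
have By : 0 <= B * (y - 2) by rewrite mulr_ge0// subr_ge0 ltW.
have e2 : 0 <= eps ^+ 2 := sqr_ge0 eps.
have l1 : eps ^+ 2 * (th * lap h (phi n.-1) p.1 p.2) <= eps ^+ 2 * (th * (4 / h ^+ 2 * (2 - x))).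
  by apply: ler_wpM2l => //; apply: ler_wpM2l => //; exact: ltW.
have l2 : eps ^+ 2 * ((1 - th) * lap h (phi n) p.1 p.2) <= 0.
  rewrite mulr_ge0_le0//; apply: mulr_ge0_le0 => //; lra.
have e3 : (2 - x) * (th * (a0 - 4 * eps ^+ 2 / h ^+ 2)) =
  th * a0 * (2 - x) - eps ^+ 2 * (th * (4 / h ^+ 2 * (2 - x))) by ring.
rewrite e3 in key; rewrite -/x (mulrDr (eps ^+ 2)).
exact: (max_point_balance R _ _ _ _ _ _ _ _ key fy' l1 l2 By).
Qed.

Lemma scheme_norm_le (phi : nat -> grid R M) : 2 / 5 <= al ->
  (forall i j, `|phi 0%N i j| <= 2) ->
  (forall n, (0 < n <= N)%N -> scheme_step h t al th eps phi n) ->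
  forall n, (n <= N)%N -> forall i j, `|phi n i j| <= 2.
Proof.
move=> al25 h0 hs n; elim/ltn_ind: n => -[_ _ //|n] IH nN i j.
have n0N : (0 < n.+1 <= N)%N by [].
have hk k a b : (k < n.+1)%N -> `|phi k a b| <= 2.
  by move=> kn; apply: IH => //; apply: leq_trans nN; exact: ltnW.
rewrite ler_norml (scheme_le n.+1 phi al25 n0N hk (hs _ n0N)) andbT lerNl.
apply: (scheme_le n.+1 (fun k a b => - phi k a b) al25 n0N).
- by move=> k a b kn; rewrite normrN; exact: hk.
- exact/scheme_stepN/hs.
Qed.

(** The scheme is tested with its own increment at each grid point, where kernel and double-well
    estimates apply; only the diffusion term needs the sum over the grid. *)
Lemma energy_step n (phi : nat -> grid R M) : (0 < n <= N)%N ->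
  (al <= 2 / 5 \/ forall i j, `|phi n.-1 i j| <= 2) ->
  scheme_step h t al th eps phi n ->
  menergy h t al th eps phi n - menergy h t al th eps phi n.-1 +
  al / (2 * (2 - al)) * akern t al th n 0 *
    ip h (fun i j => phi n i j - phi n.-1 i j) (fun i j => phi n i j - phi n.-1 i j) <= 0.
Proof.
move=> n0N hb hs.
pose w i j := phi n i j - phi n.-1 i j.
pose G k i j := Gfun t al th k (fun l => phi l i j - phi l.-1 i j).
pose lc := lap h (fun a b => th * phi n.-1 a b + (1 - th) * phi n a b).
set a0 := akern t al th n 0.
have a00 : 0 <= a0 := akern0_ge0 R al N t al01 tinc n n0N.
have al2 : 0 < 2 - al by have := al1; lra.
(* The constant is th / (2 (1 - th)) at th = al / 2, so this is the first step restriction. *)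
have ca : 1 <= al / (2 * (2 - al)) * a0.
  apply: le_trans (stepF n n0N) _; rewrite -/a0 le_eqVlt; apply/orP; left; apply/eqP.
  by field; rewrite gt_eqF.
have pt i j : (G n i j - G n.-1 i j) / 2 + (FAC (phi n i j) - FAC (phi n.-1 i j)) +
    al / (2 * (2 - al)) * a0 * (w i j * w i j) <= eps ^+ 2 * (lc i j * w i j).
  have hyp : th <= 1 / 5 \/ `|phi n.-1 i j| <= 2.
    by case: hb => [hb|hb]; [left; lra|right].
  have nl := double_well_increment R th (phi n.-1 i j) (phi n i j) th01 hyp.
  have gs := sum_ahat_ge R al rs S N t al01 tinc rs_ge S01 rsS hr hS n
    (fun l => phi l i j - phi l.-1 i j) n0N.
  have := hs i j.
  rewrite (L2sigma_ahat R al rs N t al01 tinc rs_ge hr n _ n0N) -/lc -/a0.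
  move: gs; rewrite -/(G n i j) -/(G n.-1 i j).
  set Y := \sum_(1 <= k < n.+1) _; rewrite -/(w i j) => gs sch.
  have sq : 1 * (w i j * w i j) <= al / (2 * (2 - al)) * a0 * (w i j * w i j).
    by apply: ler_wpM2r => //; rewrite -expr2 sqr_ge0.
  move: nl gs sch sq; rewrite -/(w i j).
  set f := th * _ + (1 - th) * _; set W := w i j.
  have -> : al / (2 - al) * a0 = 2 * (al / (2 * (2 - al)) * a0) by field; rewrite gt_eqF.
  move=> nl gs sch sq; rewrite [leRHS]mulrA.
  by apply: energy_balance gs sch _ sq; rewrite lerBlDr -lerBlDr.
have hsum : \sum_i \sum_j ((G n i j - G n.-1 i j) / 2 + (FAC (phi n i j) - FAC (phi n.-1 i j)) +
    al / (2 * (2 - al)) * a0 * (w i j * w i j)) <= eps ^+ 2 * \sum_i \sum_j lc i j * w i j.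
  rewrite mulr_sumr; apply: ler_sum => i _; rewrite mulr_sumr; apply: ler_sum => j _.
  exact: pt.
have th2 : th <= 1 / 2 by case/andP: th01 => _ /ltW.
have gr := gradsq_theta_le R M h th (phi n.-1) (phi n) th2.
have hh : 0 <= h ^+ 2 := sqr_ge0 h.
have e2 : 0 <= eps ^+ 2 := sqr_ge0 eps.
have h1 := ler_wpM2l hh hsum.
have h2 : h ^+ 2 * (eps ^+ 2 * \sum_i \sum_j lc i j * w i j) <=
    eps ^+ 2 * (- (1 / 2) * (gradsq h (phi n) - gradsq h (phi n.-1))).
  by rewrite mulrCA; apply: ler_wpM2l.
have -> : menergy h t al th eps phi n - menergy h t al th eps phi n.-1 + al / (2 * (2 - al)) * a0 * ip h w w
  = eps ^+ 2 * (1 / 2 * (gradsq h (phi n) - gradsq h (phi n.-1))) +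
  h ^+ 2 * \sum_i \sum_j ((G n i j - G n.-1 i j) / 2 + (FAC (phi n i j) - FAC (phi n.-1 i j)) +
    al / (2 * (2 - al)) * a0 * (w i j * w i j)).
  have -> : \sum_i \sum_j ((G n i j - G n.-1 i j) / 2 + (FAC (phi n i j) - FAC (phi n.-1 i j)) +
    al / (2 * (2 - al)) * a0 * (w i j * w i j)) =
    (\sum_i \sum_j G n i j * 1 - \sum_i \sum_j G n.-1 i j * 1) / 2 +
    (\sum_i \sum_j FAC (phi n i j) * 1 - \sum_i \sum_j FAC (phi n.-1 i j) * 1) +
    al / (2 * (2 - al)) * a0 * (\sum_i \sum_j w i j * w i j).
    rewrite -!sumrB mulr_suml mulr_sumr -!big_split/=; apply: eq_bigr => i _.
    rewrite -!sumrB mulr_suml mulr_sumr -!big_split/=; apply: eq_bigr => j _.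
    by rewrite !mulr1.
  have E (g g' F F' G1 G2 c W k e : R) :
      e / 2 * g + k * F + 1 / 2 * (k * G1) - (e / 2 * g' + k * F' + 1 / 2 * (k * G2)) +
      c * (k * W) =
      e * (1 / 2 * (g - g')) + k * ((G1 - G2) / 2 + (F - F') + c * W) by field.
  exact: E.
exact: (total_balance R _ _ _ _ h1 h2).
Qed.
End Scheme.

Theorem theorem3p2 (R : realType) (alpha eps L h rs : R) (M N : nat)
    (t : nat -> R) (phi : nat -> 'I_M -> 'I_M -> R) :
  0 < alpha < 1 -> 0 < eps -> 0 < L -> (0 < M)%N -> h = L / M%:R ->
  t 0%N = 0 -> (forall k, (k < N)%N -> t k < t k.+1) ->
  (forall i j, `|phi 0%N i j| <= 1) ->
  0 < rs -> rstar_eq alpha rs = 0 ->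
  (forall k, (2 <= k <= N)%N -> rs <= mratio t k) ->
  (forall n, (1 <= n <= N)%N ->
     mtau t n <= Num.min
       ((alpha / 2 * omegaF (2 - alpha) (1 - alpha / 2) / (2 * (1 - alpha / 2)))
          `^ (1 / alpha))
       ((h ^+ 2 * omegaF (2 - alpha) (1 - alpha / 2) / (4 * eps ^+ 2))
          `^ (1 / alpha))) ->
  (forall n, (1 <= n <= N)%N -> scheme_step h t alpha (alpha / 2) eps phi n) ->
  forall n, (1 <= n <= N)%N ->
    (menergy h t alpha (alpha / 2) eps phi n
       - menergy h t alpha (alpha / 2) eps phi n.-1) / mtau t n
    + alpha / (2 * (2 - alpha)) * akern t alpha (alpha / 2) n 0 * mtau t n
      * ip h (fun i j => (phi n i j - phi n.-1 i j) / mtau t n)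
             (fun i j => (phi n i j - phi n.-1 i j) / mtau t n)
    <= 0.
Proof.
move=> al01 eps0 L0 M0 hE _ tinc phi0 rs0 rsE hr step hs n n0N.
have [S [S0 S1 rsS hS rs_ge]] := rstar_bounds R alpha rs al01 rs0 rsE.
have S01 : 0 <= S <= 1 by rewrite S0 S1.
have h0 : 0 < h by rewrite hE divr_gt0// ltr0n.
have /andP[al0 al1] := al01.
have th1 : 0 < 1 - alpha / 2 by lra.
have stepF k : (0 < k <= N)%N ->
    1 <= alpha / 2 / (2 * (1 - alpha / 2)) * akern t alpha (alpha / 2) k 0.
  move=> kN; apply: (akern0_step_ge R alpha N t al01 tinc k _ kN).
    by rewrite divr_gt0 ?mulr_gt0 ?divr_gt0.
  by have := step k kN; rewrite le_min => /andP[+ _]; rewrite mulrAC.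
have stepD k : (0 < k <= N)%N ->
    4 * eps ^+ 2 / h ^+ 2 <= akern t alpha (alpha / 2) k 0.
  move=> kN.
  have h2 : 0 < h ^+ 2 by rewrite exprn_gt0.
  have e2 : 0 < 4 * eps ^+ 2 by rewrite mulr_gt0// exprn_gt0.
  have B0 : 0 < h ^+ 2 / (4 * eps ^+ 2) by rewrite divr_gt0.
  have : 1 <= h ^+ 2 / (4 * eps ^+ 2) * akern t alpha (alpha / 2) k 0.
    apply: (akern0_step_ge R alpha N t al01 tinc k _ kN) => //.
    by have := step k kN; rewrite le_min => /andP[_ +]; rewrite mulrAC.
  by rewrite mulrAC ler_pdivlMr// mul1r ler_pdivrMr// (mulrC (h ^+ 2)).
(* The two regimes of [double_well_increment], split at theta = 1/5; in the second the initial bound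
   1 is relaxed to 2 and propagated in time. *)
have hb : alpha <= 2 / 5 \/ forall i j, `|phi n.-1 i j| <= 2.
  have [hal|/ltW hal] := leP alpha (2 / 5); [by left|right].
  apply: (scheme_norm_le R alpha rs S eps h M N t al01 tinc rs_ge S01 rsS hr hS stepD) => //.
    by move=> i j; apply: le_trans (phi0 i j) _; lra.
  by case/andP: n0N => _; apply: leq_trans; exact: leq_pred.
have := energy_step R alpha rs S eps h M N t al01 tinc rs_ge S01 rsS hr hS stepF n phi
  n0N hb (hs n n0N).
have tau0 := mtau_gt0 R N t tinc n n0N.
rewrite (ipZZ R M h (mtau t n) (fun i j => phi n i j - phi n.-1 i j)).
set E := menergy _ _ _ _ _ _ n - _; set I := ip _ _ _; set c := _ / _ * _ => hE0.
have -> : E / mtau t n + c * mtau t n * (I / mtau t n ^+ 2) = (E + c * I) / mtau t n.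
  by field; rewrite gt_eqF.
by apply: mulr_le0_ge0 => //; rewrite invr_ge0 ltW.
Qed.
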